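(* Let $n$ be a positive integer, let $\alpha>0$, and for $1\le \ell\le n$ let $\mathbb{Q}^{(n,\ell,\alpha)}$ be the generator of the labelled exclusion process on the complete graph on $n$ vertices with parameters $\ell$ and $\alpha$. Let $\mathcal{E}^n_0,\ldots,\mathcal{E}^n_n$ be the sets defined in the context. Then, with $n$ fixed, the following hold. (1) $\mathcal{S}(-\mathbb{Q}^{(n,\ell,\alpha)})$ is increasing in $\ell$ (with respect to inclusion), and $\mathcal{S}(-\mathbb{Q}^{(n,\ell,\alpha)})\subset\mathcal{E}^n_\ell$ for all $\ell$. (2) $\mathcal{S}(-\mathbb{Q}^{(n,n,\alpha)})$ is contained in the largest subset of $\mathcal{E}^n_n$ that is symmetric around $\alpha\binom n2$; equivalently, $\mathcal{S}(\mathbb{A}_n)$ is symmetric around $0$ and is contained in the largest subset of $\binom n2-\alpha^{-1}\mathcal{E}^n_n$ that is symmetric around $0$. (3) If $1\le j\le\min(\ell,n-\ell)$, then the total multiplicity of the eigenvalues $\lambda$ of $-\mathbb{Q}^{(n,\ell,\alpha)}$ such that $\alpha j(n-j+1)\le\lambda<\alpha(j+1)(n-j)$ does not exceed $(n)_j\binom\ell j$. (4) For all $\ell$, the multiplicity of the eigenvalue $\alpha n$ of $-\mathbb{Q}^{(n,\ell,\alpha)}$ is exactly $\ell(n-1)$.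
   Context: Let $V$ be the vertex set of the complete graph on $n$ vertices. $(V)_\ell$ denotes the set of ordered $\ell$-tuples $x=(v_1,\ldots,v_\ell)$ of distinct elements of $V$ ($v_j$ is the position of ball $j$), and $(n)_\ell=n(n-1)\cdots(n-\ell+1)=|(V)_\ell|$. The labelled exclusion process (LEP) with parameters $\ell$ ($1\le\ell\le n$) and $\alpha>0$ is the continuous time Markov process on $(V)_\ell$ with generator $\mathbb{Q}^{(n,\ell,\alpha)}=[q_{x,x'}]_{x,x'\in(V)_\ell}$ given by $q_{x,x}=-\alpha\left(\ell(n-\ell)+\binom\ell2\right)$; $q_{x,x'}=\alpha$ whenever $x$ and $x'$ differ in exactly one coordinate (the position of exactly one ball) or $x'$ can be obtained from $x$ by interchanging two of its coordinates; and $q_{x,x'}=0$ otherwise. For a square matrix $\mathbb{B}$, $\mathcal{S}(\mathbb{B})$ denotes its set of eigenvalues. For $m\ge1$, $\mathbb{A}_m$ is the adjacency matrix of the Cayley graph of the symmetric group on $m$ items generated by the transpositions: the vertices are all $m!$ permutations, and $u,v$ are adjacent iff they differ by exactly one transposition. For $x,y\in\mathbb{R}$ and $A\subset\mathbb{R}$, $x(y-A)$ denotes $\{x(y-a):a\in A\}$. The sets $\mathcal{E}^n_k$ (depending on $\alpha$) are defined by $\mathcal{E}^n_0=\{0\}$, $\mathcal{E}^n_1=\{0,\alpha n\}$, inductively for $k=1,2,\ldots,n-2$, $$\mathcal{E}^n_{k+1}=\mathcal{E}^n_k\cup\left(\alpha\left(n(k+1)-\binom{k+1}2-\mathcal{S}(\mathbb{A}_{k+1})\right)\right),$$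 and $\mathcal{E}^n_n=\mathcal{E}^n_{n-1}$. A set $A\subset\mathbb{R}$ is symmetric around $c$ if $a\in A$ implies $2c-a\in A$.
   Formalization: Part (4) is stated only for ℓ<n (or n=1): for ℓ=n≥2 it is false, e.g. n=ℓ=2, where αn=2α has multiplicity 1, not 2. For n=1, where the clauses defining E^1_1 conflict, E^1_1={0} is used. *)

(* Defs.v *)
From HB Require Import structures.
From mathcomp Require Import all_boot all_order all_algebra all_fingroup.
From mathcomp Require Import boolp classical_sets fsbigop reals.
Set Implicit Arguments.
Unset Strict Implicit.
Unset Printing Implicit Defensive.
Import Order.TTheory GRing.Theory Num.Theory.
Local Open Scope classical_set_scope.
Local Open Scope ring_scope.

Definition spectrum (R : realType) (N : nat) (M : 'M[R]_N) : set R :=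
  [set a | eigenvalue M a].

(* Algebraic multiplicity; it is 0 when [a] is not an eigenvalue. *)
Definition multiplicity (R : realType) (N : nat) (M : 'M[R]_N) (a : R) : nat :=
  mup a (char_poly M).

(* [config n l] is (V)_l for V = {0, ..., n-1}; [tnth (val x) i] is the
   position of ball [i]. *)
Definition config (n l : nat) := {x : l.-tuple 'I_n | uniq x}.

Definition differ_in_one (n l : nat) (x y : config n l) : bool :=
  #|[set i : 'I_l | tnth (val x) i != tnth (val y) i]%SET| == 1%N.

Definition differ_by_swap (n l : nat) (x y : config n l) : bool :=
  [exists i : 'I_l, exists j : 'I_l, (i != j) &&
    [forall k : 'I_l, tnth (val y) k == tnth (val x) (tperm i j k)]].

Definition lep_rate (R : realType) (n l : nat) (alpha : R)
    (x y : config n l) : R :=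
  if x == y then - (alpha * (l * (n - l) + 'C(l, 2))%:R)
  else if differ_in_one x y || differ_by_swap x y then alpha
  else 0.

Definition lep_generator (R : realType) (n l : nat) (alpha : R)
    : 'M[R]_#|{: config n l}| :=
  \matrix_(i, j) lep_rate alpha (enum_val i) (enum_val j).

Definition differ_by_transposition (m : nat) (u v : 'S_m) : bool :=
  [exists a : 'I_m, exists b : 'I_m, (a != b) && (v == u * tperm a b)%g].

Definition cayley_adj (R : realType) (m : nat) : 'M[R]_#|{: 'S_m}| :=
  \matrix_(i, j) (differ_by_transposition (enum_val i) (enum_val j))%:R.

Definition scaled_diff (R : realType) (x y : R) (A : set R) : set R :=
  [set x * (y - a) | a in A].

(* Only the values 0 <= k <= n are meaningful.  The rule E_n = E_(n-1) is
   tested first, which matters only for n = 1, where it gives E_1 = {0} rather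
   than the larger set {0, alpha}. *)
Fixpoint Eset (R : realType) (alpha : R) (n k : nat) : set R :=
  match k with
  | 0 => [set 0]
  | k'.+1 =>
    if k'.+1 == n then Eset alpha n k'
    else if k' == 0%N then [set 0; alpha * n%:R]
    else Eset alpha n k' `|`
      scaled_diff alpha ((n * k'.+1)%:R - 'C(k'.+1, 2)%:R)
        (spectrum (cayley_adj R k'.+1))
  end.

Definition symmetric_around (R : realType) (c : R) (A : set R) : Prop :=
  forall a, A a -> A (2 * c - a).

Definition largest_symmetric_subset (R : realType) (c : R) (A : set R) : set R :=
  \bigcup_(B in [set B : set R | B `<=` A /\ symmetric_around c B]) B.

Lemma largest_symmetric_subsetP (R : realType) (c : R) (A : set R) :
  [/\ largest_symmetric_subset c A `<=` A,
      symmetric_around c (largest_symmetric_subset c A) &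
      forall B : set R, B `<=` A -> symmetric_around c B ->
        B `<=` largest_symmetric_subset c A].
Proof.
split=> [a [B [BA _] Ba]|a [B [BA Bs] Ba]|B BA Bs a Ba].
- exact: BA.
- by exists B => //; exact: Bs.
- by exists B.
Qed.

(* Main.v *)
Require Import Defs.
From HB Require Import structures.
From mathcomp Require Import all_boot all_order all_algebra all_fingroup.
From mathcomp Require Import boolp classical_sets fsbigop reals.
From mathcomp Require Import zify ring lra.
Set Implicit Arguments.
Unset Strict Implicit.
Unset Printing Implicit Defensive.
Import Order.TTheory GRing.Theory Num.Theory.
Local Open Scope classical_set_scope.
Local Open Scope ring_scope.

(** The generator is a sum over the transpositions of the vertex set: letting
    [tperm a b] act on the positions of the balls, for all ordered pairs (a, b),
    and adding up gives an operator T on functions of configurations with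
    - Q = (alpha / 2) (n ^ 2 - T)  (lep_generator_colE).  An eigenvalue lambda
    of - Q is thus an eigenvalue c = n ^ 2 - 2 lambda / alpha of T.  As T is
    built from the action on vertices, it commutes with everything defined in
    terms of the labels of the balls only.

    In particular T commutes with the marginals, which forget one ball and sum
    over its position.  So if an eigenfunction with l balls has a nonzero
    marginal, that marginal is an eigenfunction with l - 1 balls for the same c
    (eigenfunction_marginal).  If all marginals vanish, summing f over the
    vacant targets of one ball gives - f, and the vertex transpositions
    collapse to T f = ((n - l) ^ 2 - 2 l) f + A f, where A sums f over the
    exchanges of the labels i and j, for all ordered pairs (i, j)
    (transposition_sum_marginal0).  Along the orbit of one configuration under
    relabelling the balls, A is l + 2 A_l with A_l the adjacency matrix of the
    Cayley graph.  By induction on l this yields the inclusion in the sets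
    E_l; for l = n there is no vacant vertex, so a function with zero marginals
    vanishes and E_n = E_(n-1) suffices.  Conversely a function of l balls is a
    function of l + 1 balls, whence the monotonicity.  When l = n,
    configurations are permutations and T is n + 2 A_n; multiplying by the
    signature reverses the sign of A_n, which gives the symmetry.

    For the multiplicities, let S be a space of functions stable under - Q.
    The characteristic polynomial is a product p q with deg p = dim S, where
    every root of q is an eigenvalue with an eigenvector orthogonal to S
    (char_poly_stablemx).  Take for S the span of the functions of at most j
    balls, which is generated by n ^_ j * 'C(l, j) indicators of cylinders.  An
    eigenfunction orthogonal to S has no nonzero marginal on j balls.  So the
    process of taking nonzero marginals stops at some k > j with a function all
    of whose marginals vanish; as A <= k ^ 2, the eigenvalue is at least
    alpha k (n - k + 1) (eigenfunction_level_bound).  This is at least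
    alpha (j + 1) (n - j) when k <= n - j, so no eigenvalue of the window is a
    root of q, and their total multiplicity is at most deg p.  For the
    eigenvalue alpha n, let S be spanned by the contrasts
    1_(x_i = v) - 1_(x_i = 0): these are l (n - 1) independent eigenfunctions,
    and an eigenfunction orthogonal to them has zero mean, hence is orthogonal
    to the functions of one ball, hence has an eigenvalue at least
    alpha k (n - k + 1) > alpha n with 2 <= k < n. *)

(** * Characteristic polynomials and stable subspaces *)

Lemma char_poly_conjmx (F : fieldType) (N : nat) (P M : 'M[F]_N) :
  P \in unitmx -> char_poly (P *m M *m invmx P) = char_poly M.
Proof.
move=> uP; rewrite /char_poly.
have -> : char_poly_mx (P *m M *m invmx P) =
    map_mx polyC P *m char_poly_mx M *m map_mx polyC (invmx P).
  rewrite /char_poly_mx mulmxBr mulmxBl -!map_mxM /=; congr (_ - _).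
  by rewrite scalar_mxC -mulmxA -map_mxM mulmxV //= map_mx1 mulmx1.
rewrite !det_mulmx mulrAC -det_mulmx -map_mxM mulmxV //= map_mx1 det1 mul1r.
by [].
Qed.

Lemma char_poly_trmx (F : comNzRingType) (N : nat) (M : 'M[F]_N) :
  char_poly M^T = char_poly M.
Proof.
rewrite /char_poly -[RHS]det_tr; congr (\det _).
by rewrite /char_poly_mx linearB /= tr_scalar_mx map_trmx.
Qed.

Lemma char_poly_lblock (F : comNzRingType) (r s : nat) (A : 'M[F]_r)
    (C : 'M[F]_(s, r)) (D : 'M[F]_s) :
  char_poly (block_mx A 0 C D) = char_poly A * char_poly D.
Proof.
rewrite /char_poly -(det_lblock _ (- map_mx polyC C)); congr (\det _).
rewrite /char_poly_mx map_block_mx map_mx0 /= (scalar_mx_block r s).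
by rewrite opp_block_mx add_block_mx oppr0 !addr0 add0r.
Qed.

Lemma char_poly_scalar (F : comNzRingType) (r : nat) (c : F) :
  char_poly (c%:M : 'M[F]_r) = ('X - c%:P) ^+ r.
Proof.
by rewrite /char_poly /char_poly_mx map_scalar_mx -raddfB det_scalar.
Qed.

Lemma eigenvalue_colP (F : fieldType) (N : nat) (M : 'M[F]_N) (a : F) :
  reflect (exists2 w : 'cV[F]_N, M *m w = a *: w & w != 0) (eigenvalue M a).
Proof.
rewrite eigenvalue_root_char -char_poly_trmx -eigenvalue_root_char.
apply: (iffP eigenvalueP) => -[v vM vn0]; exists v^T.
- by rewrite -[M]trmxK -trmx_mul vM linearZ.
- by rewrite -trmx0 (inj_eq trmx_inj).
- by rewrite -trmx_mul vM linearZ.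
- by rewrite -trmx0 (inj_eq trmx_inj).
Qed.

Lemma col_neq0 (F : nmodType) (N : nat) (w : 'cV[F]_N) :
  w != 0 -> exists i, w i 0 != 0.
Proof.
move=> wn0; apply/existsP; apply: contraNT wn0.
rewrite negb_exists => /forallP w0; apply/eqP/colP => i; rewrite mxE.
by apply/eqP; have := w0 i; rewrite negbK.
Qed.

(** In a basis whose first [r] vectors span the stable subspace, the matrix is
    lower block triangular; the two diagonal blocks give the two factors.  The
    rank [r] is a variable here so that the decomposition [N = r + s] can be
    substituted in the types. *)
Lemma char_poly_stable_pid (F : fieldType) (r s N : nat) (M E : 'M[F]_N)
    (V := (pid_mx r : 'M_(r, N)) *m E) :
  N = (r + s)%N -> E \in unitmx -> (V *m M <= V)%MS ->
  exists p q : {poly F},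
    [/\ char_poly M = p * q, size p = r.+1,
        forall c, V *m M = c *: V -> p = ('X - c%:P) ^+ r &
        forall a, root q a ->
          exists w : 'cV[F]_N, [/\ w != 0, V *m w = 0 & M *m w = a *: w]].
Proof.
move=> eN; subst N => uE /submxP[A VM].
have pidE : pid_mx r = row_mx 1%:M 0 :> 'M[F]_(r, r + s) by rewrite pid_mx_row.
pose B := E *m M *m invmx E; pose C := dlsubmx B; pose D := drsubmx B.
have EM : E *m M = B *m E by rewrite mulmxKV.
have uB : row_mx 1%:M 0 *m B = row_mx A 0.
  rewrite -pidE !mulmxA -/V VM /V mulmxA mulmxK // pidE.
  by rewrite mul_mx_row mulmx1 mulmx0.
have Bblock : B = block_mx A 0 C D.
  rewrite -[LHS]vsubmxK -[dsubmx B]hsubmxK; congr col_mx.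
  by rewrite -uB -[B in RHS]vsubmxK mul_row_col mul1mx mul0mx addr0.
exists (char_poly A), (char_poly D); split.
- by rewrite -(char_poly_lblock _ C) -Bblock char_poly_conjmx.
- exact: size_char_poly.
- move=> c VMc; rewrite -char_poly_scalar; congr char_poly.
  have : A *m V = c%:M *m V by rewrite mul_scalar_mx -VMc VM.
  move=> /(congr1 (mulmx^~ (invmx E))); rewrite /V !mulmxA !mulmxK // pidE.
  by rewrite !mul_mx_row !mulmx1 !mulmx0 => /eq_row_mx[].
- move=> a; rewrite -eigenvalue_root_char => /eigenvalue_colP[z Dz zn0].
  exists (invmx E *m col_mx 0 z); split.
  + apply: contra_neq zn0 => /(congr1 (mulmx E)); rewrite mulKVmx // mulmx0.
    by rewrite -[X in _ = X](@col_mx0 _ r s) => /eq_col_mx[].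
  + by rewrite /V mulmxA mulmxK // pidE mul_row_col mulmx0 mul0mx addr0.
  + have -> : M = invmx E *m B *m E by rewrite -mulmxA -EM mulKmx.
    rewrite Bblock !mulmxA mulmxK // -mulmxA mul_block_col !mulmx0 mul0mx Dz.
    by rewrite !add0r scalemxAr scale_col_mx scaler0.
Qed.

(** Separates the eigenvalues of [M] according to a stable row space: [p] is the
    characteristic polynomial of the restriction, [q] that of the quotient, whose
    eigenvectors are read off in the dual as column vectors killed by [S].  A
    factorisation of [char_poly M] controls algebraic multiplicities without
    diagonalising [M]. *)
Lemma char_poly_stablemx (F : fieldType) (m N : nat) (S : 'M[F]_(m, N))
    (M : 'M[F]_N) :
  (S *m M <= S)%MS ->
  exists p q : {poly F},
    [/\ char_poly M = p * q, size p = (\rank S).+1,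
        forall c, S *m M = c *: S -> p = ('X - c%:P) ^+ \rank S &
        forall a, root q a ->
          exists w : 'cV[F]_N, [/\ w != 0, S *m w = 0 & M *m w = a *: w]].
Proof.
move=> SM; have SV : (S :=: row_base S)%MS := eqmx_sym (eq_row_base S).
have SVM : (row_base S *m M <= row_base S)%MS.
  by rewrite -SV (submx_trans _ SM) // submxMr // SV.
have [|p [q [Mpq sp pc qw]]] := @char_poly_stable_pid F (\rank S)
    (N - \rank S)%N N M (row_ebase S) _ (row_ebase_unit S) SVM.
  by rewrite subnKC // rank_leq_col.
exists p, q; split=> // [c Sc|a /qw[w [wn0 Vw Mw]]].
  have /submxP[X VX] : (row_base S <= S)%MS by rewrite SV.
  by apply: pc; rewrite -/(row_base S) VX -mulmxA Sc scalemxAr.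
exists w; split=> //; have /submxP[X ->] : (S <= row_base S)%MS by rewrite -SV.
by rewrite -mulmxA [_ *m w]Vw mulmx0.
Qed.

Lemma sum_mup_le (F : fieldType) (s : seq F) (p : {poly F}) :
  p != 0 -> uniq s -> (\sum_(a <- s) mup a p < size p)%N.
Proof.
elim: s p => [|a s IH] p pn0 /=; first by rewrite big_nil size_poly_gt0.
case/andP=> as_ us; rewrite big_cons.
have /dvdpP[q pq] : ('X - a%:P) ^+ mup a p %| p by rewrite -mup_geq.
have Xn0 : ('X - a%:P) ^+ mup a p != 0 by rewrite expf_neq0 // polyXsubC_eq0.
have qn0 : q != 0 by apply: contraNneq pn0 => q0; rewrite pq q0 mul0r.
have -> : size p = (mup a p + size q)%N.
  by rewrite [in LHS]pq size_mul // size_exp_XsubC addnS addnC.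
rewrite ltn_add2l.
rewrite (leq_ltn_trans _ (IH q qn0 us)) // leq_eqVlt; apply/orP; left.
apply/eqP; rewrite !big_seq; apply: eq_bigr => b bs.
rewrite [in LHS]pq mupMl // /root horner_exp hornerXsubC expf_eq0 subr_eq0 negb_and.
by rewrite (memPn as_) ?orbT.
Qed.

(** * Moving balls and transposing vertices *)

Definition relabel (n l : nat) (s : 'S_n) (x : l.-tuple 'I_n) : l.-tuple 'I_n :=
  [tuple s (tnth x i) | i < l].

Definition reorder (n l : nat) (x : l.-tuple 'I_n) (t : 'S_l) : l.-tuple 'I_n :=
  [tuple tnth x (t i) | i < l].

Definition insert_ball (n l : nat) (i : 'I_l.+1) (v : 'I_n)
    (y : l.-tuple 'I_n) : l.+1.-tuple 'I_n :=
  [tuple oapp (tnth y) v (unlift i k) | k < l.+1].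

Definition delete_ball (n l : nat) (i : 'I_l.+1) (x : l.+1.-tuple 'I_n) :
    l.-tuple 'I_n :=
  [tuple tnth x (lift i k) | k < l].

Lemma relabel_uniq (n l : nat) (s : 'S_n) (x : l.-tuple 'I_n) :
  uniq (relabel s x) = uniq x.
Proof.
apply/tuple_uniqP/tuple_uniqP => inj i j eij.
  by apply: inj; rewrite !tnth_mktuple eij.
by apply: inj; move: eij; rewrite !tnth_mktuple => /perm_inj.
Qed.

Lemma relabel1 (n l : nat) (x : l.-tuple 'I_n) : relabel 1 x = x.
Proof. by apply: eq_from_tnth => i; rewrite tnth_mktuple perm1. Qed.

Lemma relabelM (n l : nat) (s t : 'S_n) (x : l.-tuple 'I_n) :
  relabel (s * t) x = relabel t (relabel s x).
Proof. by apply: eq_from_tnth => i; rewrite !tnth_mktuple permM. Qed.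

Lemma relabel_tpermK (n l : nat) (a b : 'I_n) :
  involutive (@relabel n l (tperm a b)).
Proof. by move=> x; rewrite -relabelM tperm2 relabel1. Qed.

Lemma relabel_tperm_fix (n l : nat) (x : l.-tuple 'I_n) (a b : 'I_n) :
  (relabel (tperm a b) x == x) = (a == b) || (a \notin x) && (b \notin x).
Proof.
apply/eqP/idP => [e|/orP[/eqP->|/andP[ax bx]]].
- rewrite -implyNb; apply/implyP => ab; rewrite -negb_or.
  apply/negP => /orP[] /tnthP[k xk]; have := congr1 (fun y => tnth y k) e;
    rewrite tnth_mktuple -xk ?tpermL ?tpermR => ba; by rewrite ba eqxx in ab.
- by rewrite tperm1 relabel1.
- apply: eq_from_tnth => k; rewrite tnth_mktuple tpermD //.
    by apply: contraNneq ax => ->; rewrite mem_tnth.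
  by apply: contraNneq bx => ->; rewrite mem_tnth.
Qed.

Lemma reorder_uniq (n l : nat) (x : l.-tuple 'I_n) (t : 'S_l) :
  uniq (reorder x t) = uniq x.
Proof.
apply/tuple_uniqP/tuple_uniqP => inj i j.
  move=> eij; apply: (@perm_inj _ t^-1%g); apply: inj.
  by rewrite !tnth_mktuple !permKV.
by rewrite !tnth_mktuple => /inj /perm_inj.
Qed.

Lemma relabel_insert (n l : nat) (s : 'S_n) (i : 'I_l.+1) (v : 'I_n)
    (y : l.-tuple 'I_n) :
  relabel s (insert_ball i v y) = insert_ball i (s v) (relabel s y).
Proof.
apply: eq_from_tnth => k; rewrite !tnth_mktuple.
by case: (unlift i k) => //= k'; rewrite tnth_mktuple.
Qed.

Lemma relabel_delete (n l : nat) (s : 'S_n) (i : 'I_l.+1)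
    (x : l.+1.-tuple 'I_n) :
  relabel s (delete_ball i x) = delete_ball i (relabel s x).
Proof. by apply: eq_from_tnth => k; rewrite !tnth_mktuple. Qed.

Lemma insert_deleteE (n l : nat) (i : 'I_l.+1) (v : 'I_n)
    (x : l.+1.-tuple 'I_n) (k : 'I_l.+1) :
  tnth (insert_ball i v (delete_ball i x)) k = if k == i then v else tnth x k.
Proof.
rewrite tnth_mktuple; case: unliftP => [k' ->|->] /=; last by rewrite eqxx.
by rewrite tnth_mktuple eq_sym (negPf (neq_lift i k')).
Qed.

Lemma insert_deleteK (n l : nat) (i : 'I_l.+1) (x : l.+1.-tuple 'I_n) :
  insert_ball i (tnth x i) (delete_ball i x) = x.
Proof.
by apply: eq_from_tnth => k; rewrite insert_deleteE; case: eqP => // ->.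
Qed.

Lemma delete_insertK (n l : nat) (i : 'I_l.+1) (v : 'I_n) (y : l.-tuple 'I_n) :
  delete_ball i (insert_ball i v y) = y.
Proof. by apply: eq_from_tnth => k; rewrite !tnth_mktuple liftK. Qed.

Lemma tnth_insert (n l : nat) (i : 'I_l.+1) (v : 'I_n) (y : l.-tuple 'I_n) :
  tnth (insert_ball i v y) i = v.
Proof. by rewrite tnth_mktuple unlift_none. Qed.

Lemma tnth_insert_lift (n l : nat) (i : 'I_l.+1) (v : 'I_n) (y : l.-tuple 'I_n)
    (k : 'I_l) : tnth (insert_ball i v y) (lift i k) = tnth y k.
Proof. by rewrite tnth_mktuple liftK. Qed.

Lemma delete_uniq (n l : nat) (i : 'I_l.+1) (x : l.+1.-tuple 'I_n) :
  uniq x -> uniq (delete_ball i x).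
Proof.
move=> /tuple_uniqP inj; apply/tuple_uniqP => j k.
by rewrite !tnth_mktuple => /inj /lift_inj.
Qed.

Lemma insert_uniq (n l : nat) (i : 'I_l.+1) (v : 'I_n) (y : l.-tuple 'I_n) :
  uniq (insert_ball i v y) = (v \notin y) && uniq y.
Proof.
apply/idP/andP => [ux|[vy /tuple_uniqP inj]].
  split; last by rewrite -(delete_insertK i v y) delete_uniq.
  apply/negP => /tnthP[k vk]; move/tuple_uniqP: ux => /(_ i (lift i k)).
  rewrite tnth_insert tnth_insert_lift => /(_ vk) /eqP.
  by rewrite (negPf (neq_lift i k)).
apply/tuple_uniqP => j k; rewrite !tnth_mktuple.
case: unliftP => [j' ->|->] /=; case: unliftP => [k' ->|->] //=.
- by move=> /inj ->.
- by move=> e; rewrite -e mem_tnth in vy.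
- by move=> e; rewrite e mem_tnth in vy.
Qed.

(** Ordered pairs, the diagonal included, are used so that sums over vertices
    can be split and reindexed without any order on them; each transposition is
    counted twice and the identity [n] times. *)
Definition transposition_sum (R : nmodType) (n l : nat)
    (f : l.-tuple 'I_n -> R) (x : l.-tuple 'I_n) : R :=
  \sum_(a < n) \sum_(b < n) f (relabel (tperm a b) x).

(** Functions on configurations are extended by 0 to all tuples, which lets
    marginals range over all vertices. *)
Definition supported_on_configs (R : nmodType) (n l : nat)
    (f : l.-tuple 'I_n -> R) : Prop :=
  forall x : l.-tuple 'I_n, ~~ uniq x -> f x = 0.

Definition marginal (R : nmodType) (n l : nat) (i : 'I_l.+1)
    (f : l.+1.-tuple 'I_n -> R) (y : l.-tuple 'I_n) : R :=
  \sum_(v < n) f (insert_ball i v y).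

Lemma marginal_supported (R : nmodType) (n l : nat) (i : 'I_l.+1)
    (f : l.+1.-tuple 'I_n -> R) :
  supported_on_configs f -> supported_on_configs (marginal i f).
Proof.
move=> sf y uy; apply: big1 => v _; apply: sf.
by rewrite insert_uniq (negPf uy) andbF.
Qed.

(** A vertex transposition also permutes the positions summed over. *)
Lemma marginal_transposition_sum (R : nmodType) (n l : nat) (i : 'I_l.+1)
    (f : l.+1.-tuple 'I_n -> R) (y : l.-tuple 'I_n) :
  marginal i (transposition_sum f) y = transposition_sum (marginal i f) y.
Proof.
rewrite /marginal /transposition_sum exchange_big; apply: eq_bigr => a _.
rewrite exchange_big; apply: eq_bigr => b _.
rewrite [RHS](reindex_inj (@perm_inj _ (tperm a b))).
by apply: eq_bigr => v _; rewrite relabel_insert.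
Qed.

Lemma sum_mem_tuple (R : nmodType) (n l : nat) (x : l.-tuple 'I_n)
    (F : 'I_n -> R) :
  uniq x -> \sum_(a in x) F a = \sum_(i < l) F (tnth x i).
Proof. by move=> ux; rewrite -big_uniq // big_tuple. Qed.

Lemma card_notin_tuple (n l : nat) (x : l.-tuple 'I_n) :
  uniq x -> #|[predC x]| = (n - l)%N.
Proof.
move=> ux; have := cardC (mem x).
by rewrite card_ord (card_uniqP ux) size_tuple => en;
  rewrite -[X in (X - _)%N]en addKn.
Qed.

(** Splits the pairs (a, b) according to which of the two vertices are occupied:
    two vacant vertices change nothing, an occupied and a vacant one move a
    ball, and two occupied ones exchange two balls. *)
Lemma transposition_sumE (R : pzRingType) (n l : nat)
    (f : l.+1.-tuple 'I_n -> R) (x : l.+1.-tuple 'I_n) :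
  uniq x ->
  transposition_sum f x = ((n - l.+1) ^ 2)%:R * f x
    + 2 * (\sum_(i < l.+1) \sum_(v < n | v \notin x)
             f (insert_ball i v (delete_ball i x)))
    + \sum_(i < l.+1) \sum_(j < l.+1) f (reorder x (tperm i j)).
Proof.
move=> ux; have /tuple_uniqP inj := ux.
have move1 i b : b \notin x ->
    relabel (tperm (tnth x i) b) x = insert_ball i b (delete_ball i x).
  move=> bx; apply: eq_from_tnth => k; rewrite insert_deleteE tnth_mktuple.
  case: eqVneq => [->|ki]; first by rewrite tpermL.
  rewrite tpermD // ?(inj_eq inj) 1?eq_sym //.
  by apply: contraNneq bx => <-; rewrite mem_tnth.
have swap i j : relabel (tperm (tnth x i) (tnth x j)) x = reorder x (tperm i j).
  by apply: eq_from_tnth => k; rewrite !tnth_mktuple inj_tperm.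
have stay a b : a \notin x -> b \notin x -> relabel (tperm a b) x = x.
  by move=> ax bx; apply/eqP; rewrite relabel_tperm_fix ax bx orbT.
have inner a : \sum_(b < n) f (relabel (tperm a b) x) =
    \sum_(i < l.+1) f (relabel (tperm a (tnth x i)) x)
    + \sum_(b | b \notin x) f (relabel (tperm a b) x).
  by rewrite (bigID (mem x)) /= sum_mem_tuple.
rewrite /transposition_sum (bigID (mem x)) /= sum_mem_tuple //.
have inside i : \sum_(b < n) f (relabel (tperm (tnth x i) b) x) =
    \sum_(j < l.+1) f (reorder x (tperm i j))
    + \sum_(v | v \notin x) f (insert_ball i v (delete_ball i x)).
  rewrite inner; congr (_ + _); apply: eq_bigr => b bx; first by rewrite swap.
  by rewrite move1.
have outside a : a \notin x -> \sum_(b < n) f (relabel (tperm a b) x) =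
    \sum_(i < l.+1) f (insert_ball i a (delete_ball i x))
    + (n - l.+1)%:R * f x.
  move=> ax; rewrite inner; congr (_ + _).
    by apply: eq_bigr => i _; rewrite tpermC move1.
  rewrite (eq_bigr (fun=> f x)) => [|b bx]; last by rewrite stay.
  by rewrite sumr_const card_notin_tuple // mulr_natl.
rewrite (eq_bigr _ (fun i _ => inside i)) (eq_bigr _ outside).
rewrite !big_split /= sumr_const card_notin_tuple //.
rewrite [X in _ + (X + _)]exchange_big /= -mulrnAl -mulrnA mulnn.
rewrite -[2]/(1 + 1) mulrDl !mul1r.
set A := \sum_i \sum_j _; set B := \sum_i \sum_(v | _) _.
by rewrite [RHS]addrC -!addrA; congr (_ + _); rewrite addrA addrC.
Qed.

(** The marginal at ball [i] sums over the vacant vertices, over the current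
    position of [i], which contributes [f x], and over the positions of the
    other balls, which contribute 0. *)
Lemma sum_vacant_marginal0 (R : zmodType) (n l : nat) (i : 'I_l.+1)
    (f : l.+1.-tuple 'I_n -> R) (x : l.+1.-tuple 'I_n) :
  supported_on_configs f -> uniq x -> marginal i f (delete_ball i x) = 0 ->
  \sum_(v < n | v \notin x) f (insert_ball i v (delete_ball i x)) = - f x.
Proof.
move=> sf ux; rewrite /marginal (bigID (mem x)) /= sum_mem_tuple //.
rewrite (bigD1 i) //= insert_deleteK big1 ?addr0; last first.
  move=> k ki; apply: sf; rewrite insert_uniq negb_and negbK.
  have [k' -> |ik] := unliftP i k; last by rewrite ik eqxx in ki.
  by rewrite -(tnth_mktuple (fun k => tnth x (lift i k))) mem_tnth.
by move=> /eqP; rewrite addrC addr_eq0 => /eqP.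
Qed.

Lemma transposition_sum_marginal0 (R : pzRingType) (n l : nat)
    (f : l.+1.-tuple 'I_n -> R) (x : l.+1.-tuple 'I_n) :
  supported_on_configs f -> (forall i y, marginal i f y = 0) -> uniq x ->
  transposition_sum f x = ((n - l.+1) ^ 2)%:R * f x - (2 * l.+1)%:R * f x
    + \sum_(i < l.+1) \sum_(j < l.+1) f (reorder x (tperm i j)).
Proof.
move=> sf mf ux; rewrite transposition_sumE //; congr (_ + _ + _).
under eq_bigr do rewrite sum_vacant_marginal0 //.
by rewrite sumr_const card_ord mulNrn mulrN natrM -mulrA -[f x *+ _]mulr_natl.
Qed.

(** * Eigenfunctions and their marginals *)

Definition eigenfunction (R : pzRingType) (n l : nat) (c : R)
    (f : l.-tuple 'I_n -> R) : Prop :=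
  [/\ supported_on_configs f, exists x, f x != 0 &
      forall x, transposition_sum f x = c * f x].

Lemma eigenfunction_marginal (R : pzRingType) (n l : nat) (c : R)
    (f : l.+1.-tuple 'I_n -> R) :
  eigenfunction c f ->
  (exists i, eigenfunction c (marginal i f)) \/ (forall i y, marginal i f y = 0).
Proof.
move=> [sf _ Tf]; have [/existsP[i /existsP[y iy]]|none] :=
  boolP [exists i, exists y, marginal i f y != 0]; [left | right].
  exists i; split; [exact: marginal_supported | by exists y |] => z.
  rewrite -marginal_transposition_sum /marginal mulr_sumr.
  by apply: eq_bigr => v _; exact: Tf.
move=> i y; apply/eqP; apply: contraNT none => iy.
by apply/existsP; exists i; apply/existsP; exists y.
Qed.

Lemma fresh_vertex (n l : nat) (x : l.-tuple 'I_n) :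
  uniq x -> (l < n)%N -> exists v, v \notin x.
Proof.
move=> ux ln; have : (0 < #|[predC x]|)%N by rewrite card_notin_tuple ?subn_gt0.
by case/card_gt0P => v vx; exists v.
Qed.

(** Ignoring the additional ball commutes with the action on vertices; the
    lifted function is nonzero because some vertex is vacant. *)
Lemma eigenfunction_lift (R : pzRingType) (n l : nat) (c : R)
    (f : l.-tuple 'I_n -> R) :
  (l < n)%N -> eigenfunction c f ->
  exists g : l.+1.-tuple 'I_n -> R, eigenfunction c g.
Proof.
move=> ln [sf [y fy] Tf].
exists (fun x : l.+1.-tuple 'I_n => if uniq x then f (delete_ball ord0 x) else 0);
  split.
- by move=> x /negPf->.
- have uy : uniq y by apply: contraNT fy => /sf->.
  have [v vy] := fresh_vertex uy ln; exists (insert_ball ord0 v y).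
  by rewrite insert_uniq vy uy delete_insertK.
move=> x; rewrite /transposition_sum.
under eq_bigr do under eq_bigr do rewrite relabel_uniq -relabel_delete.
case: ifP => _; first exact: Tf.
by rewrite mulr0 big1 // => a _; rewrite big1.
Qed.

(** When every vertex is occupied, the sum over vacant vertices is empty. *)
Lemma supported_vanish_full (R : zmodType) (n l : nat)
    (f : l.+1.-tuple 'I_n -> R) :
  (n <= l.+1)%N -> supported_on_configs f ->
  (forall i y, marginal i f y = 0) -> forall x, f x = 0.
Proof.
move=> nl sf mf x; have [ux|/sf//] := boolP (uniq x).
have := sum_vacant_marginal0 sf ux (mf ord0 _).
rewrite big_pred0 => [/esym/eqP|v].
  by rewrite oppr_eq0 => /eqP.
apply/negbTE/negP => vx; have : (0 < #|[predC x]|)%N by apply/card_gt0P; exists v.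
by rewrite card_notin_tuple // (eqP (nl : (n - l.+1)%N == 0%N)).
Qed.

Lemma eigenfunction_marginal0 (R : comNzRingType) (n l : nat) (c : R)
    (f : l.+1.-tuple 'I_n -> R) (x : l.+1.-tuple 'I_n) :
  eigenfunction c f -> (forall i y, marginal i f y = 0) ->
  \sum_(i < l.+1) \sum_(j < l.+1) f (reorder x (tperm i j)) =
  (c - ((n - l.+1) ^ 2)%:R + (2 * l.+1)%:R) * f x.
Proof.
move=> [sf _ Tf] mf; have [ux|ux] := boolP (uniq x); last first.
  rewrite [f x]sf // mulr0 big1 // => i _; rewrite big1 // => j _.
  by rewrite sf // reorder_uniq.
rewrite mulrDl mulrBl -Tf transposition_sum_marginal0 //.
by ring.
Qed.

(** Evaluate at a point where the absolute value of [f] is maximal. *)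
Lemma double_sum_eigenvalue_le (R : realFieldType) (n l : nat) (s : R)
    (f : l.-tuple 'I_n -> R) :
  (exists x, f x != 0) ->
  (forall x, \sum_(i < l) \sum_(j < l) f (reorder x (tperm i j)) = s * f x) ->
  s <= (l ^ 2)%:R.
Proof.
move=> [x0 fx0] Af.
pose x := [arg max_(x > x0) `|f x|]%O.
have xmax y : `|f y| <= `|f x|.
  by rewrite /x; case: arg_maxP => //= z _; apply.
have fx : 0 < `|f x| by rewrite (lt_le_trans _ (xmax x0)) // normr_gt0.
rewrite -(ler_pM2r fx) (le_trans (ler_norm _)) // normrM normr_id -normrM -Af.
rewrite (le_trans (ler_norm_sum _ _ _)) //.
have -> : (l ^ 2)%:R * `|f x| = \sum_(i < l) \sum_(j < l) `|f x|.
  by rewrite !sumr_const !card_ord -mulrnA mulr_natl.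
apply: ler_sum => i _; rewrite (le_trans (ler_norm_sum _ _ _)) //.
exact: ler_sum.
Qed.

(** Summing over the position of ball [i] turns a cylinder on the remaining balls
    into the cylinder with the same constraints; [v0] only completes [z] to a
    tuple with a coordinate for [i]. *)
Lemma marginal_cylinder (R : nmodType) (n l : nat) (i : 'I_l.+1)
    (f : l.+1.-tuple 'I_n -> R) (J : {set 'I_l}) (z : l.-tuple 'I_n) (v0 : 'I_n) :
  \sum_(y : l.-tuple 'I_n | [forall k in J, tnth y k == tnth z k]) marginal i f y =
  \sum_(x : l.+1.-tuple 'I_n | [forall k in [set lift i k | k in J]%SET,
                         tnth x k == tnth (insert_ball i v0 z) k]) f x.
Proof.
rewrite /marginal pair_big /=.
rewrite (reindex (fun x : l.+1.-tuple 'I_n => (delete_ball i x, tnth x i))) /=.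
  apply: eq_big => [x|x _]; last by rewrite insert_deleteK.
  rewrite andbT; apply/forall_inP/forall_inP => h k.
    by case/imsetP => k' kJ ->; have := h _ kJ; rewrite tnth_insert_lift tnth_mktuple.
  move=> kJ; have := h (lift i k) (imset_f _ kJ).
  by rewrite tnth_insert_lift tnth_mktuple.
exists (fun p => insert_ball i p.2 p.1) => [x _|[y v] _] /=.
  by rewrite insert_deleteK.
by rewrite delete_insertK tnth_insert.
Qed.

Lemma cylinder_full (R : nmodType) (n l j : nat) (f : l.-tuple 'I_n -> R) :
  (forall (J : {set 'I_l}) (z : l.-tuple 'I_n), #|J| = j ->
     \sum_(x : l.-tuple 'I_n | [forall k in J, tnth x k == tnth z k]) f x = 0) ->
  j = l -> forall z, f z = 0.
Proof.
move=> mf jl z; have := mf [set: 'I_l]%SET z; rewrite cardsT card_ord jl.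
move=> /(_ erefl); rewrite (bigD1 z) /=; last by apply/forall_inP => k.
rewrite big1 => [|y /andP[/forall_inP yz]]; first by rewrite addr0.
by case/eqP; apply: eq_from_tnth => k; apply/eqP/yz; rewrite inE.
Qed.

(** If all marginals of [f] on [j] balls vanish, delete balls as long as some
    marginal is nonzero.  The process stops at some [k] with [j < k], since the
    hypothesis at [k = j] would kill the function; the bound on [c] is then the
    one for functions with zero marginals. *)
Lemma eigenfunction_level_bound (R : realFieldType) (n l j : nat) (c : R)
    (f : l.-tuple 'I_n -> R) :
  (j <= l <= n)%N -> eigenfunction c f ->
  (forall (J : {set 'I_l}) (z : l.-tuple 'I_n), #|J| = j ->
     \sum_(x : l.-tuple 'I_n | [forall k in J, tnth x k == tnth z k]) f x = 0) ->
  exists k : nat, [/\ (j < k <= l)%N, (k < n)%N &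
    c <= ((n - k) ^ 2)%:R - (2 * k)%:R + (k ^ 2)%:R].
Proof.
elim: l f => [|l IH] f /andP[jl ln] ef mf;
  have [sf nf Tf] := ef; have [x fx] := nf.
  by move: fx; rewrite (cylinder_full mf) ?eqxx //; apply/eqP; rewrite -leqn0.
have [jl'|jl'] := ltnP l j.
  move: fx; rewrite (cylinder_full mf) ?eqxx //.
  by apply/eqP; rewrite eqn_leq jl.
have [[i ei]|m0] := eigenfunction_marginal ef; last first.
  exists l.+1; rewrite leqnn ltnS jl'.
  have lt : (l.+1 < n)%N.
    rewrite ltnNge; apply/negP => nl; case/eqP: fx.
    exact: supported_vanish_full.
  have := double_sum_eigenvalue_le nf (fun x => eigenfunction_marginal0 x ef m0).
  by split=> //; lra.
have [||k [jk kn ck]] := IH _ _ ei.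
- by rewrite jl' ltnW.
- move=> J z Jj; have [v0 _] : exists v0 : 'I_n, true by exists (Ordinal ln).
  rewrite (marginal_cylinder i f J z v0); apply: mf.
  by rewrite card_imset //; exact: lift_inj.
by exists k; split=> //; case/andP: jk => -> /leqW.
Qed.

(** * The Cayley graph of the transpositions *)

Lemma natr_bin2 (R : realFieldType) (k : nat) :
  'C(k, 2)%:R = (k%:R * (k%:R - 1)) / 2 :> R.
Proof.
case: k => [|k]; first by rewrite bin0n mul0r mul0r.
have : ('C(k.+1, 2) * 2 = k.+1 * k)%N by rewrite muln2 bin2 -[RHS]odd_double_half
  oddM /= andNb.
move=> /(congr1 (fun m => m%:R : R)); rewrite !natrM => e.
have -> : k.+1%:R - 1 = k%:R :> R by rewrite -addn1 natrD addrK.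
by rewrite -e mulfK // pnatr_eq0.
Qed.

Lemma tperm_moves (n : nat) (a b z w : 'I_n) :
  tperm a b z = w -> w != z -> (a == z) && (b == w) || (a == w) && (b == z).
Proof. by case: tpermP => [->|->|_ _] -> //; rewrite ?eqxx ?orbT. Qed.

(** A transposition arises from exactly two ordered pairs, whence the factors 2
    relating sums over pairs to rates and to adjacency. *)
Lemma sum_pair_indicator (R : pzSemiRingType) (n : nat) (P : rel 'I_n)
    (z w : 'I_n) :
  z != w -> P z w -> P w z ->
  (forall a b, P a b -> (a == z) && (b == w) || (a == w) && (b == z)) ->
  \sum_(a < n) \sum_(b < n) (P a b)%:R = 2 :> R.
Proof.
move=> zw Pzw Pwz PE; have row a c : (forall b, P a b = (b == c)) ->
    \sum_(b < n) (P a b)%:R = 1 :> R.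
  move=> Pa; rewrite (bigD1 c) //= Pa eqxx big1 ?addr0 // => b bc.
  by rewrite Pa (negPf bc).
have rowz : \sum_(b < n) (P z b)%:R = 1 :> R.
  apply: (row z w) => b; apply/idP/eqP => [/PE|-> //].
  by rewrite eqxx (negPf zw) /= orbF => /eqP.
have roww : \sum_(b < n) (P w b)%:R = 1 :> R.
  apply: (row w z) => b; apply/idP/eqP => [/PE|-> //].
  by rewrite eqxx eq_sym (negPf zw) /= => /eqP.
rewrite (bigD1 z) //= rowz (bigD1 w) 1?eq_sym //= roww big1 ?addr0 //.
move=> a /andP[az aw]; rewrite big1 // => b _; case Pab: (P a b) => //.
by have := PE _ _ Pab; rewrite (negPf az) (negPf aw).
Qed.

Lemma sum_double_eq (R : pzSemiRingType) (n : nat) :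
  \sum_(a < n) \sum_(b < n) (a == b)%:R = n%:R :> R.
Proof.
rewrite -[in RHS](card_ord n) -sumr_const; apply: eq_bigr => a _.
rewrite (bigD1 a) //= eqxx big1 ?addr0 // => b ba.
by rewrite eq_sym (negPf ba).
Qed.

Lemma differ_by_transpositionP (m : nat) (u v : 'S_m) :
  reflect (exists a b, a != b /\ v = (u * tperm a b)%g)
          (differ_by_transposition u v).
Proof.
apply: (iffP existsP) => [[a /existsP[b /andP[ab /eqP e]]]|[a [b [ab e]]]].
  by exists a, b.
by exists a; apply/existsP; exists b; rewrite ab e eqxx.
Qed.

Lemma cayley_transposition_count (R : nzRingType) (m : nat) (u v : 'S_m) :
  \sum_(i < m) \sum_(j < m) (v == u * tperm i j)%g%:R =
  2 * (differ_by_transposition u v)%:R + m%:R * (v == u)%:R :> R.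
Proof.
have dbtN : differ_by_transposition u u = false.
  apply/negbTE/negP => /differ_by_transpositionP[a [b [ab e]]].
  have /permP/(_ a) : tperm a b = 1%g by apply: (mulgI u); rewrite mulg1.
  by rewrite tpermL perm1 => ba; rewrite ba eqxx in ab.
have [->|vu] := eqVneq v u.
  rewrite dbtN mulr0 add0r mulr1 -[RHS](sum_double_eq R m).
  apply: eq_bigr => i _; apply: eq_bigr => j _; congr (_%:R); congr nat_of_bool.
  have [->|ij] := eqVneq i j; first by rewrite tperm1 mulg1 eqxx.
  apply/negbTE/negP => /eqP e; suff: differ_by_transposition u u by rewrite dbtN.
  by apply/differ_by_transpositionP; exists i, j.
rewrite mulr0 addr0; have [|nd] := boolP (differ_by_transposition u v).
  case/differ_by_transpositionP=> a [b [ab ve]]; rewrite mulr1.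
  apply: (@sum_pair_indicator R m (fun i j => v == u * tperm i j)%g a b ab);
    rewrite ?ve ?eqxx //; first by rewrite tpermC.
  move=> i j /eqP /mulgI /permP/(_ a); rewrite tpermL => /esym e.
  by apply: tperm_moves e _; rewrite eq_sym.
rewrite mulr0 big1 // => i _; rewrite big1 // => j _; case: eqP => // ve.
case/negP: nd; apply/differ_by_transpositionP; exists i, j; split=> //.
apply: contra_neq vu => ij.
by rewrite ve ij tperm1 mulg1.
Qed.

(** The diagonal pairs contribute the term in [m]. *)
Lemma cayley_transposition_sum (R : nzRingType) (m : nat) (h : 'S_m -> R)
    (u : 'S_m) :
  \sum_(i < m) \sum_(j < m) h (u * tperm i j)%g =
  2 * (\sum_v (differ_by_transposition u v)%:R * h v) + m%:R * h u.
Proof.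
have -> : h u = \sum_v (v == u)%:R * h v.
  rewrite (bigD1 u) //= eqxx mul1r big1 ?addr0 // => v /negPf->.
  by rewrite mul0r.
rewrite !mulr_sumr -big_split /=.
under [RHS]eq_bigr => v _.
  rewrite !mulrA -mulrDl -cayley_transposition_count mulr_suml.
  under eq_bigr do rewrite mulr_suml.
  over.
rewrite [RHS]exchange_big; apply: eq_bigr => i _.
rewrite [RHS]exchange_big; apply: eq_bigr => j _.
rewrite (bigD1 (u * tperm i j)%g) //= eqxx mul1r big1 ?addr0 // => v /negPf->.
by rewrite mul0r.
Qed.

Definition transposition_eigenfunction (R : pzRingType) (m : nat) (s : R)
    (h : 'S_m -> R) : Prop :=
  (exists u, h u != 0) /\
  forall u, \sum_(i < m) \sum_(j < m) h (u * tperm i j)%g = s * h u.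

Lemma spectrum_cayleyP (R : realType) (m : nat) (a : R) :
  spectrum (cayley_adj R m) a <->
  exists h : 'S_m -> R, transposition_eigenfunction (m%:R + 2 * a) h.
Proof.
have adjE (h : 'S_m -> R) u :
    (cayley_adj R m *m \col_i h (enum_val i)) (enum_rank u) 0 =
    \sum_v (differ_by_transposition u v)%:R * h v.
  rewrite mxE [RHS](reindex_onto enum_val enum_rank) => [|v _].
    by apply: eq_big => i; rewrite ?enum_valK ?eqxx // !mxE enum_rankK.
  exact: enum_rankK.
split=> [/eigenvalue_colP[w Aw wn0]|[h [[u hu] Th]]].
  exists (fun u => w (enum_rank u) 0); split.
    have [i wi] := col_neq0 wn0.
    by exists (enum_val i); rewrite enum_valK.
  move=> u; rewrite (cayley_transposition_sum (fun u => w (enum_rank u) 0)) -adjE.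
  have -> : \col_i w (enum_rank (enum_val i)) 0 = w.
    by apply/colP => i; rewrite mxE enum_valK.
  by rewrite Aw mxE; ring.
apply/eigenvalue_colP; exists (\col_i h (enum_val i)).
  apply/colP => i; rewrite -(enum_valK i) adjE !mxE enum_rankK.
  have := Th (enum_val i); rewrite cayley_transposition_sum mulrDl => e.
  by lra.
apply: contraNneq hu => /colP/(_ (enum_rank u)); rewrite !mxE enum_rankK.
by move=> ->.
Qed.

(** Every edge of the graph joins an even and an odd permutation, so multiplying
    an eigenfunction by the signature negates its eigenvalue. *)
Lemma spectrum_cayley_sym (R : realType) (m : nat) :
  symmetric_around 0 (spectrum (cayley_adj R m)).
Proof.
move=> a /spectrum_cayleyP[h [[u hu] Th]]; rewrite mulr0 sub0r.
apply/spectrum_cayleyP; exists (fun u => (-1) ^+ odd_perm u * h u); split.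
  by exists u; rewrite mulf_neq0 // signr_eq0.
move=> v; have := cayley_transposition_sum h v; rewrite Th mulrDl => eh.
rewrite (cayley_transposition_sum (fun u => (-1) ^+ odd_perm u * h u)).
have -> : \sum_v0 (differ_by_transposition v v0)%:R * ((-1) ^+ odd_perm v0 * h v0)
   = - (-1) ^+ odd_perm v * \sum_v0 (differ_by_transposition v v0)%:R * h v0.
  rewrite mulr_sumr; apply: eq_bigr => w _.
  have [|] := boolP (differ_by_transposition v w); last by rewrite !mul0r mulr0.
  case/differ_by_transpositionP=> i [j [ij ->]]; rewrite !mul1r.
  by rewrite odd_permM odd_tperm ij addbT signrN.
move: (\sum_v0 _) eh => X eh; have -> : X = a * h v by lra.
by move: ((-1) ^+ _) => e; ring.
Qed.

(** * The generator as a transposition sum *)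

Lemma config_leq (n l : nat) (x : config n l) : (l <= n)%N.
Proof.
by rewrite -[X in (X <= _)%N](size_tuple (val x)) -(card_uniqP (valP x))
  -[X in (_ <= X)%N](card_ord n) max_card.
Qed.

Lemma relabel_tperm_fix_count (R : pzSemiRingType) (n l : nat)
    (x : l.-tuple 'I_n) :
  uniq x ->
  \sum_(a < n) \sum_(b < n) (relabel (tperm a b) x == x)%:R =
  (l + (n - l) ^ 2)%:R :> R.
Proof.
move=> ux; rewrite (bigID (mem x)) /= (eq_bigr (fun=> 1)); last first.
  move=> a ax; rewrite (bigD1 a) //= relabel_tperm_fix eqxx big1 ?addr0 //.
  by move=> b ba; rewrite relabel_tperm_fix eq_sym (negPf ba) ax.
rewrite sumr_const (card_uniqP ux) size_tuple natrD; congr (_ + _).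
rewrite (eq_bigr (fun=> (n - l)%:R)); last first.
  move=> a ax; rewrite (bigID (mem x)) /= big1 ?add0r; last first.
    move=> b bx; rewrite relabel_tperm_fix bx andbF orbF.
    by case: eqP => // ab; rewrite ab bx in ax.
  rewrite (eq_bigr (fun=> 1)); last first.
    by move=> b bx; rewrite relabel_tperm_fix ax bx orbT.
  by rewrite sumr_const card_notin_tuple.
by rewrite sumr_const card_notin_tuple // -mulrnA mulnn.
Qed.

(** A ball moving to a vacant vertex and two balls exchanging their positions
    are both the effect of a single transposition of vertices. *)
Lemma neighbourP (n l : nat) (x y : config n l) :
  x != y ->
  reflect (exists a b, relabel (tperm a b) (val x) = val y)
          (differ_in_one x y || differ_by_swap x y).
Proof.
move=> xy; have /tuple_uniqP injx := valP x; have /tuple_uniqP injy := valP y.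
apply: (iffP orP) => [[/cards1P[k dk]|]|[a [b e]]].
- have xyP i : (tnth (val x) i == tnth (val y) i) = (i != k).
    by have /setP/(_ i) := dk; rewrite !inE => <-; rewrite negbK.
  exists (tnth (val x) k), (tnth (val y) k).
  apply: eq_from_tnth => i; rewrite tnth_mktuple.
  have [->|ik] := eqVneq i k; first by rewrite tpermL.
  rewrite tpermD; first by apply/eqP; rewrite xyP.
    by rewrite (inj_eq injx) eq_sym.
  have /eqP-> : tnth (val x) i == tnth (val y) i by rewrite xyP.
  by rewrite (inj_eq injy) eq_sym.
- move=> /existsP[i /existsP[j /andP[ij /forallP yE]]].
  exists (tnth (val x) i), (tnth (val x) j); apply: eq_from_tnth => k.
  by rewrite tnth_mktuple -(inj_tperm _ _ _ injx) (eqP (yE k)).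
have [k xyk] : exists k, tnth (val x) k != tnth (val y) k.
  apply/existsP; apply: contraNT xy; rewrite negb_exists => /forallP h.
  apply/eqP/val_inj/eq_from_tnth => k; apply/eqP.
  by have := h k; rewrite negbK.
have {e} e : relabel (tperm (tnth (val x) k) (tnth (val y) k)) (val x) = val y.
  have := congr1 (fun z => tnth z k) e; rewrite tnth_mktuple => ek.
  have /orP[/andP[/eqP<- /eqP<-] //|/andP[/eqP<- /eqP<-]] := tperm_moves ek
    (contraNN (fun h => etrans (eq_sym _ _) h) xyk).
  by rewrite tpermC.
have [/tnthP[m ym]|yx] := boolP (tnth (val y) k \in val x).
  right; apply/existsP; exists k; apply/existsP; exists m; apply/andP; split.
    by apply: contraNneq xyk => km; rewrite ym -km.
  apply/forallP => i; rewrite -{1}e tnth_mktuple.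
  by rewrite ym (inj_tperm _ _ _ injx).
left; apply/cards1P; exists k; apply/setP => i; rewrite !inE.
have [->|ik] := eqVneq i k; first exact: xyk.
apply/negbTE; rewrite negbK -e tnth_mktuple tpermD ?(inj_eq injx) 1?eq_sym //.
by apply: contraNneq yx => <-; rewrite mem_tnth.
Qed.

(** Off the diagonal, the two ordered pairs of the only transposition that maps
    [x] to [y] account for twice the rate; on the diagonal, the pairs that fix
    [x] are the equal ones and those of vacant vertices. *)
Lemma lep_rate_count (R : realType) (n l : nat) (alpha : R) (x y : config n l) :
  alpha * (\sum_(a < n) \sum_(b < n) (relabel (tperm a b) (val x) == val y)%:R)
  = 2 * lep_rate alpha x y + alpha * (n ^ 2)%:R * (x == y)%:R.
Proof.
rewrite /lep_rate; have [<-|xy] := eqVneq x y.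
  rewrite relabel_tperm_fix_count ?(valP x) // mulr1.
  rewrite !natrD natrM !natrX natrB ?(config_leq x) // natr_bin2.
  by field.
rewrite mulr0 addr0; case: (neighbourP xy) => [[a [b e]]|nab]; last first.
  rewrite mulr0 big1 ?mulr0 // => a _; rewrite big1 // => b _.
  by case: eqP => // e; case: nab; exists a, b.
have [k xk] : exists k, tperm a b (tnth (val x) k) != tnth (val x) k.
  apply/existsP; apply: contraNT xy; rewrite negb_exists => /forallP h.
  apply/eqP/val_inj; rewrite -e; apply: eq_from_tnth => k; apply/eqP.
  by have := h k; rewrite negbK tnth_mktuple eq_sym.
set z := tnth (val x) k in xk; set w := tperm a b z in xk.
have abzw : tperm a b = tperm z w.
  have /orP[/andP[/eqP<- /eqP<-] //|/andP[/eqP<- /eqP<-]] :=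
    tperm_moves (erefl w) xk.
  by rewrite tpermC.
rewrite mulrC; congr (_ * _).
apply: (@sum_pair_indicator R n
  (fun a b => relabel (tperm a b) (val x) == val y) z w).
- by rewrite eq_sym.
- by rewrite -abzw e.
- by rewrite tpermC -abzw e.
move=> c d /eqP cde; apply: tperm_moves xk.
by have := congr1 (fun t => tnth t k) (etrans cde (esym e));
  rewrite !tnth_mktuple.
Qed.

Lemma lep_rate_sym (R : realType) (n l : nat) (alpha : R) (x y : config n l) :
  lep_rate alpha x y = lep_rate alpha y x.
Proof.
have := lep_rate_count alpha x y; have := lep_rate_count alpha y x.
rewrite [y == x]eq_sym.
have -> : \sum_(a < n) \sum_(b < n) (relabel (tperm a b) (val y) == val x)%:R =
   \sum_(a < n) \sum_(b < n) (relabel (tperm a b) (val x) == val y)%:R :> R.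
  apply: eq_bigr => a _; apply: eq_bigr => b _.
  by rewrite -(inj_eq (inv_inj (relabel_tpermK a b))) relabel_tpermK eq_sym.
by move=> -> ?; lra.
Qed.

Lemma lep_generator_sym (R : realType) (n l : nat) (alpha : R) :
  (lep_generator n l alpha)^T = lep_generator n l alpha.
Proof. by apply/matrixP => i j; rewrite !mxE lep_rate_sym. Qed.

Definition col_of_fun (R : pzRingType) (n l : nat) (f : l.-tuple 'I_n -> R) :
    'cV[R]_#|{: config n l}| := \col_i f (val (enum_val i)).

Definition fun_of_col (R : pzRingType) (n l : nat)
    (w : 'cV[R]_#|{: config n l}|) (x : l.-tuple 'I_n) : R :=
  oapp (fun c : config n l => w (enum_rank c) 0) 0 (insub x).

Lemma fun_of_col_supported (R : pzRingType) (n l : nat)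
    (w : 'cV[R]_#|{: config n l}|) : supported_on_configs (fun_of_col w).
Proof. by move=> x ux; rewrite /fun_of_col insubF //; apply/negbTE. Qed.

Lemma fun_of_colK (R : pzRingType) (n l : nat) (w : 'cV[R]_#|{: config n l}|) :
  col_of_fun (fun_of_col w) = w.
Proof.
by apply/colP => i; rewrite mxE /fun_of_col valK /= enum_valK.
Qed.

Lemma sum_configs (R : pzRingType) (n l : nat) (f : l.-tuple 'I_n -> R) :
  supported_on_configs f ->
  \sum_(i < #|{: config n l}|) f (val (enum_val i)) = \sum_x f x.
Proof.
move=> sf; rewrite [RHS](bigID (fun x : l.-tuple 'I_n => uniq x)) /=.
rewrite [X in _ = _ + X]big1 ?addr0 //.
rewrite [RHS](reindex_omap val (insub : _ -> option (config n l))) /=.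
  rewrite [LHS](reindex_onto enum_rank enum_val) => [|i _].
    by apply: eq_big => c; rewrite ?enum_rankK // eqxx (valP c) valK eqxx.
  exact: enum_valK.
by move=> x ux; rewrite insubT.
Qed.

Lemma sum_indicator (R : pzSemiRingType) (T : finType) (x : T) (f : T -> R) :
  \sum_y (x == y)%:R * f y = f x.
Proof.
rewrite (bigD1 x) //= eqxx mul1r big1 ?addr0 // => y yx.
by rewrite eq_sym (negPf yx) mul0r.
Qed.

Lemma lep_generator_colE (R : realType) (n l : nat) (alpha : R)
    (f : l.-tuple 'I_n -> R) (x : config n l) :
  supported_on_configs f ->
  ((- lep_generator n l alpha) *m col_of_fun f) (enum_rank x) 0 =
  alpha / 2 * ((n ^ 2)%:R * f (val x) - transposition_sum f (val x)).
Proof.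
move=> sf; rewrite mulNmx !mxE.
have rateE y : lep_rate alpha x y = alpha / 2 *
    (\sum_(a < n) \sum_(b < n) (relabel (tperm a b) (val x) == val y)%:R)
    - alpha / 2 * (n ^ 2)%:R * (x == y)%:R.
  by have := lep_rate_count alpha x y; lra.
pose count z : R := \sum_(a < n) \sum_(b < n) (relabel (tperm a b) (val x) == z)%:R.
have sum_count : \sum_z count z * f z = transposition_sum f (val x).
  under eq_bigr do rewrite mulr_suml.
  rewrite exchange_big; apply: eq_bigr => a _.
  under eq_bigr do rewrite mulr_suml.
  by rewrite exchange_big; apply: eq_bigr => b _; rewrite sum_indicator.
have summand i : lep_generator n l alpha (enum_rank x) i * col_of_fun f i 0 =
    alpha / 2 * (count (val (enum_val i)) * f (val (enum_val i)))
    - alpha / 2 * (n ^ 2)%:R *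
      ((val x == val (enum_val i))%:R * f (val (enum_val i))).
  by rewrite !mxE enum_rankK rateE (inj_eq val_inj) /count; ring.
rewrite (eq_bigr _ (fun i _ => summand i)) sumrB -!mulr_sumr.
rewrite (sum_configs (f := fun z => count z * f z)); last first.
  by move=> z /sf->; rewrite mulr0.
rewrite (sum_configs (f := fun z => (val x == z)%:R * f z)); last first.
  by move=> z /sf->; rewrite mulr0.
by rewrite sum_count sum_indicator; ring.
Qed.

Lemma lep_eigen_fun_of_col (R : realType) (n l : nat) (alpha lambda : R)
    (w : 'cV[R]_#|{: config n l}|) :
  alpha != 0 -> (- lep_generator n l alpha) *m w = lambda *: w -> w != 0 ->
  eigenfunction ((n ^ 2)%:R - 2 * lambda / alpha) (fun_of_col w).
Proof.
move=> a0 Qw wn0; have sf := fun_of_col_supported w; split=> [//||x].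
  have [i wi] := col_neq0 wn0.
  by exists (val (enum_val i)); rewrite /fun_of_col valK /= enum_valK.
have [ux|ux] := boolP (uniq x); last first.
  rewrite sf // mulr0 /transposition_sum big1 // => a _; rewrite big1 // => b _.
  by rewrite sf // relabel_uniq.
have := lep_generator_colE alpha (exist _ x ux) sf; rewrite fun_of_colK Qw mxE /=.
have -> : w (enum_rank (exist _ x ux : config n l)) 0 = fun_of_col w x.
  by rewrite /fun_of_col insubT /=.
move=> e; apply: (mulfI a0); apply/eqP; rewrite -subr_eq0; apply/eqP.
move: e; move: (fun_of_col w x) (transposition_sum _ _) => u T e.
have -> : alpha * (((n ^ 2)%:R - 2 * lambda / alpha) * u) =
  alpha * (n ^ 2)%:R * u - 2 * (lambda * u) by field.
by rewrite e; field.
Qed.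

Lemma lep_eigen_col_of_fun (R : realType) (n l : nat) (alpha lambda : R)
    (f : l.-tuple 'I_n -> R) :
  alpha != 0 -> supported_on_configs f ->
  (forall x, transposition_sum f x = ((n ^ 2)%:R - 2 * lambda / alpha) * f x) ->
  (- lep_generator n l alpha) *m col_of_fun f = lambda *: col_of_fun f.
Proof.
move=> a0 sf Tf; apply/colP => i; rewrite -(enum_valK i) lep_generator_colE //.
by rewrite Tf !mxE enum_rankK; field.
Qed.

Lemma spectrum_lepP (R : realType) (n l : nat) (alpha lambda : R) :
  alpha != 0 ->
  spectrum (- lep_generator n l alpha) lambda <->
  exists f : l.-tuple 'I_n -> R,
    eigenfunction ((n ^ 2)%:R - 2 * lambda / alpha) f.
Proof.
move=> a0; split=> [/eigenvalue_colP[w Qw wn0]|[f [sf [x fx] Tf]]].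
  by exists (fun_of_col w); exact: lep_eigen_fun_of_col.
apply/eigenvalue_colP; exists (col_of_fun f).
  exact: lep_eigen_col_of_fun.
have ux : uniq x by apply: contraNT fx => /sf->.
apply: contraNneq fx => /colP/(_ (enum_rank (exist _ x ux : config n l))).
by rewrite !mxE enum_rankK => ->.
Qed.

(** * Inclusions between spectra *)

(** Translates an eigenvalue of the transposition sum on functions with zero
    marginals, where [s] comes from exchanging labels, into the formula defining
    [Eset]; [(s - k) / 2] is the eigenvalue of the adjacency matrix. *)
Lemma level_lambda (R : realFieldType) (n k : nat) (alpha lambda s : R) :
  (k <= n)%N -> alpha != 0 ->
  (n ^ 2)%:R - 2 * lambda / alpha = ((n - k) ^ 2)%:R - (2 * k)%:R + s ->
  lambda = alpha * ((n * k)%:R - 'C(k, 2)%:R - (s - k%:R) / 2).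
Proof.
move=> kn a0; rewrite natr_bin2 !natrX !natrM natrB // => e.
have -> : lambda = alpha * (2 * lambda / alpha) / 2 by field.
have -> : 2 * lambda / alpha = n%:R ^+ 2 - ((n%:R - k%:R) ^+ 2 - 2 * k%:R + s).
  by rewrite -e; ring.
by field.
Qed.

Lemma Eset_subS (R : realType) (alpha : R) (n k : nat) :
  Eset alpha n k `<=` Eset alpha n k.+1.
Proof.
move=> x /=; case: ifP => // _; case: ifP => [/eqP->|_] /=; last by left.
by move=> ->; left.
Qed.

(** Restrict [f] to the configurations that occupy the same vertices as some [x]
    with [f x != 0].  The inverse of [u] turns composition on the side of the
    labels into multiplication on the right. *)
Lemma spectrum_cayley_of_marginal0 (R : realType) (n l : nat) (s : R)
    (f : l.+1.-tuple 'I_n -> R) :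
  (exists x, f x != 0) ->
  (forall x, \sum_(i < l.+1) \sum_(j < l.+1) f (reorder x (tperm i j)) = s * f x) ->
  spectrum (cayley_adj R l.+1) ((s - l.+1%:R) / 2).
Proof.
move=> [x fx] Af; apply/spectrum_cayleyP.
exists (fun u => f (reorder x u^-1)%g); split=> [|u].
  exists 1%g; rewrite invg1; suff -> : reorder x 1 = x by [].
  by apply: eq_from_tnth => i; rewrite tnth_mktuple perm1.
have -> : l.+1%:R + 2 * ((s - l.+1%:R) / 2) = s by field.
rewrite -Af; apply: eq_bigr => i _; apply: eq_bigr => j _; congr f.
by apply: eq_from_tnth => k; rewrite !tnth_mktuple invMg tpermV permM.
Qed.

(** The induction starts at [l = 0], where the only eigenvalue is 0; this makes
    [l = 1] an ordinary step, whose label exchanges are trivial. *)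
Lemma eigenfunction_Eset (R : realType) (n l : nat) (alpha lambda : R)
    (f : l.-tuple 'I_n -> R) :
  alpha != 0 -> (l <= n)%N ->
  eigenfunction ((n ^ 2)%:R - 2 * lambda / alpha) f -> Eset alpha n l lambda.
Proof.
move=> a0; elim: l f => [|l IH] f ln ef.
  have [_ [x fx] /(_ x)] := ef; rewrite /transposition_sum.
  under eq_bigr do under eq_bigr do rewrite (tuple0 (relabel _ _)) -(tuple0 x).
  rewrite !sumr_const !card_ord -mulrnA mulnn -(mulr_natl (f x)) => /(mulIf fx) e.
  have : 2 * lambda / alpha = 0 by lra.
  move/eqP; rewrite !mulf_eq0 invr_eq0 (negPf a0) orbF pnatr_eq0 /=.
  by move/eqP.
have [[i ei]|m0] := eigenfunction_marginal ef.
  by apply: Eset_subS; apply: IH ei; exact: ltnW.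
have [_ nf _] := ef; have Af x := eigenfunction_marginal0 x ef m0.
have ln' : (l.+1 == n) = false.
  apply/negbTE; apply/negP => /eqP e; have [x /eqP[]] := nf.
  by have [sf _ _] := ef; apply: supported_vanish_full => //; rewrite e.
move: Af; set s := _ - _ + _ => Af.
have lamE : lambda = alpha * ((n * l.+1)%:R - 'C(l.+1, 2)%:R - (s - l.+1%:R) / 2).
  by apply: level_lambda => //; rewrite /s; ring.
rewrite /= ln'; case: ifP => [/eqP l0|_]; last first.
  right; exists ((s - l.+1%:R) / 2); last exact: esym.
  exact: spectrum_cayley_of_marginal0 Af.
right; have [x fx] := nf.
have s1 : s = 1.
  apply: (mulIf fx); rewrite -Af; move: (x) f {Af lamE s fx ef nf m0 IH}.
  rewrite l0 => {}x f; rewrite !big_ord1 mul1r; congr f.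
  by apply: eq_from_tnth => i; rewrite tnth_mktuple tperm1 perm1.
by rewrite lamE s1 l0 muln1 bin_small // subr0 subrr mul0r subr0.
Qed.

Lemma spectrum_lep_Eset (R : realType) (n l : nat) (alpha : R) :
  alpha != 0 -> (l <= n)%N ->
  spectrum (- lep_generator n l alpha) `<=` Eset alpha n l.
Proof.
move=> a0 ln lambda /(spectrum_lepP _ _ _ a0)[f].
exact: eigenfunction_Eset.
Qed.

Lemma spectrum_lep_mono (R : realType) (n l l' : nat) (alpha : R) :
  alpha != 0 -> (l <= l')%N -> (l' <= n)%N ->
  spectrum (- lep_generator n l alpha)
    `<=` spectrum (- lep_generator n l' alpha).
Proof.
move=> a0 ll l'n lambda; rewrite !spectrum_lepP // => ef.
elim: l' ll l'n => [|l' IH].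
  by rewrite leqn0 => /eqP l0 _; rewrite l0 in ef.
rewrite leq_eqVlt ltnS => /orP[/eqP<- //|ll l'n].
have [f ef'] := IH ll (ltnW l'n); exact: eigenfunction_lift l'n ef'.
Qed.

Definition tuple_of_perm (n : nat) (u : 'S_n) : n.-tuple 'I_n :=
  [tuple u i | i < n].

Lemma tuple_of_perm_uniq (n : nat) (u : 'S_n) : uniq (tuple_of_perm u).
Proof. by apply/tuple_uniqP => i j; rewrite !tnth_mktuple => /perm_inj. Qed.

Lemma relabel_tuple_of_perm (n : nat) (s u : 'S_n) :
  relabel s (tuple_of_perm u) = tuple_of_perm (u * s)%g.
Proof. by apply: eq_from_tnth => i; rewrite !tnth_mktuple permM. Qed.

Lemma tuple_of_perm_inj (n : nat) : injective (@tuple_of_perm n).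
Proof.
move=> u v e; apply/permP => i.
by have := congr1 (fun x => tnth x i) e; rewrite !tnth_mktuple.
Qed.

Lemma tuple_of_perm_onto (n : nat) (x : n.-tuple 'I_n) :
  uniq x -> exists u, x = tuple_of_perm u.
Proof.
move=> /tuple_uniqP inj; exists (perm inj).
by apply: eq_from_tnth => i; rewrite tnth_mktuple permE.
Qed.

(** With as many balls as vertices, configurations are permutations, and acting
    on vertices is multiplication on the right. *)
Lemma eigenfunction_full (R : comNzRingType) (n : nat) (c : R) :
  (exists f : n.-tuple 'I_n -> R, eigenfunction c f) <->
  (exists h : 'S_n -> R, transposition_eigenfunction c h).
Proof.
split=> [[f [sf [x fx] Tf]]|[h [[u hu] Th]]].
  have [|u xu] := @tuple_of_perm_onto n x.
    by apply: contraNT fx => /sf->.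
  exists (f \o @tuple_of_perm n); split=> [|v]; first by exists u; rewrite /= -xu.
  rewrite /= -Tf; apply: eq_bigr => a _; apply: eq_bigr => b _.
  by rewrite /= relabel_tuple_of_perm.
exists (fun x => \sum_v (x == tuple_of_perm v)%:R * h v); split.
- move=> x ux; rewrite big1 // => v _; case: eqP => [xv|]; last by rewrite mul0r.
  by rewrite xv tuple_of_perm_uniq in ux.
- exists (tuple_of_perm u); rewrite (eq_bigr (fun v => (u == v)%:R * h v)).
    by rewrite sum_indicator.
  by move=> v _; rewrite (inj_eq (@tuple_of_perm_inj n)).
move=> x; rewrite mulr_sumr.
under [RHS]eq_bigr => v _.
  rewrite mulrCA -Th mulr_sumr; under eq_bigr do rewrite mulr_sumr.
  over.
rewrite [RHS]exchange_big; apply: eq_bigr => a _.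
rewrite [RHS]exchange_big; apply: eq_bigr => b _.
rewrite (reindex_inj (mulIg (tperm a b))); apply: eq_bigr => v _.
rewrite -relabel_tuple_of_perm (inj_eq (inv_inj (relabel_tpermK a b))) //.
Qed.

Lemma spectrum_lep_full (R : realType) (n : nat) (alpha lambda : R) :
  alpha != 0 ->
  spectrum (- lep_generator n n alpha) lambda <->
  spectrum (cayley_adj R n) ('C(n, 2)%:R - lambda / alpha).
Proof.
move=> a0; rewrite spectrum_lepP // spectrum_cayleyP eigenfunction_full.
suff -> : (n ^ 2)%:R - 2 * lambda / alpha =
          n%:R + 2 * ('C(n, 2)%:R - lambda / alpha) by [].
by rewrite natr_bin2 natrX; field.
Qed.

Lemma largest_symmetric_subset_sup (R : realType) (c : R) (A B : set R) :
  symmetric_around c B -> B `<=` A -> B `<=` largest_symmetric_subset c A.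
Proof. by move=> sB BA; have [_ _] := largest_symmetric_subsetP c A; apply. Qed.

Lemma spectrum_lep_full_sym (R : realType) (n : nat) (alpha : R) :
  alpha != 0 ->
  symmetric_around (alpha * 'C(n, 2)%:R) (spectrum (- lep_generator n n alpha)).
Proof.
move=> a0 lambda; rewrite !spectrum_lep_full // => /spectrum_cayley_sym.
by congr (spectrum _ _); field.
Qed.

Lemma spectrum_cayley_Eset (R : realType) (n : nat) (alpha : R) :
  alpha != 0 ->
  spectrum (cayley_adj R n)
    `<=` [set 'C(n, 2)%:R - alpha^-1 * e | e in Eset alpha n n].
Proof.
move=> a0 a Sa; exists (alpha * ('C(n, 2)%:R - a)); last by field.
apply: spectrum_lep_Eset => //; apply/spectrum_lep_full => //.
by move: Sa; congr (spectrum _ _); field.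
Qed.

(** * Functions of j balls and eigenvalues in a window *)

Lemma lep_mul_row (R : realType) (n l : nat) (alpha : R)
    (f : l.-tuple 'I_n -> R) :
  supported_on_configs f ->
  (col_of_fun f)^T *m (- lep_generator n l alpha) =
  \row_i (alpha / 2 * ((n ^ 2)%:R * f (val (enum_val i))
                        - transposition_sum f (val (enum_val i)))).
Proof.
move=> sf; rewrite -lep_generator_sym -linearN -trmx_mul /=.
apply/rowP => i; rewrite [RHS]mxE mxE.
by rewrite -lep_generator_colE // enum_valK.
Qed.

Lemma mul_row_col_of_fun (R : pzRingType) (n l : nat) (f : l.-tuple 'I_n -> R)
    (w : 'cV[R]_#|{: config n l}|) :
  ((col_of_fun f)^T *m w) 0 0 = \sum_x f x * fun_of_col w x.
Proof.
rewrite mxE -(sum_configs (f := fun x => f x * fun_of_col w x)).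
  by apply: eq_bigr => i _; rewrite -{1}(fun_of_colK w) !mxE.
by move=> x /(fun_of_col_supported w)->; rewrite mulr0.
Qed.

Lemma sum_mup_mul_le (F : fieldType) (s : seq F) (p q : {poly F}) :
  p != 0 -> uniq s -> (forall a, a \in s -> ~~ root q a) ->
  (\sum_(a <- s) mup a (p * q) < size p)%N.
Proof.
move=> pn0 us sq; rewrite big_seq (eq_bigr (fun a => mup a p)) -?big_seq.
  exact: sum_mup_le.
by move=> a /sq rq; rewrite mupMl.
Qed.

(** Eigenvalues whose eigenvectors are never orthogonal to [S] cannot be roots
    of the quotient factor, so they are counted within the restriction to [S]. *)
Lemma sum_eigenvalues_le (R : realType) (m N : nat) (S : 'M[R]_(m, N))
    (M : 'M[R]_N) (A : set R) :
  (S *m M <= S)%MS ->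
  (forall a (w : 'cV[R]_N), A a -> w != 0 -> S *m w = 0 -> M *m w <> a *: w) ->
  leq (\big[addn/0%N]_(lambda \in A) multiplicity M lambda) (\rank S).
Proof.
move=> SM noA; have [p [q [Mpq sp _ qw]]] := char_poly_stablemx SM.
rewrite -ltnS -sp /multiplicity Mpq; apply: sum_mup_mul_le.
- by rewrite -size_poly_gt0 sp.
- exact: finite_support_uniq.
move=> a as_; apply/negP => /qw[w [wn0 Sw Mw]]; apply: noA wn0 Sw Mw.
by move: as_; case: finite_supportP => [_|X XA _ _] //; exact: XA.
Qed.

Definition restrict_balls (n l : nat) (J : {set 'I_l}) (x : l.-tuple 'I_n) :
  seq 'I_n := [seq tnth x i | i <- enum J].

(** The pairs of a set of [j] balls and of the positions of these balls, listed
    in the order of [enum]. *)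
Definition cylinder_index (n l j : nat) : finType :=
  ({J : {set 'I_l} | #|J| == j} * config n j)%type.

Definition cylinder (R : pzRingType) (n l j : nat) (r : cylinder_index n l j)
    (x : l.-tuple 'I_n) : R :=
  (uniq x && (restrict_balls (val r.1) x == val r.2 :> seq 'I_n))%:R.

Lemma cylinder_supported (R : pzRingType) (n l j : nat)
    (r : cylinder_index n l j) : supported_on_configs (cylinder R r).
Proof. by move=> x /negPf ux; rewrite /cylinder ux. Qed.

Lemma card_cylinder_index (n l j : nat) :
  #|{: cylinder_index n l j}| = (n ^_ j * 'C(l, j))%N.
Proof.
rewrite card_prod mulnC; congr (_ * _)%N.
  rewrite card_sig -[in RHS](card_ord n) -(card_uniq_tuples j predT) cardsE.
  by apply: eq_card => x; rewrite !inE [RHS]andb_idl // => _; exact/allP.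
by rewrite card_sig -[in RHS](card_ord l) -card_draws cardsE.
Qed.

Lemma val_relabel (n l : nat) (s : 'S_n) (x : l.-tuple 'I_n) :
  relabel s x = map s x :> seq 'I_n.
Proof.
rewrite -[map _ _]/(val (map_tuple s x)); congr val.
by apply: eq_from_tnth => i; rewrite tnth_mktuple tnth_map.
Qed.

Definition config_relabel (n j : nat) (s : 'S_n) (y : config n j) : config n j :=
  exist _ (relabel s (val y)) (etrans (relabel_uniq s (val y)) (valP y)).

Lemma cylinder_relabel (R : pzRingType) (n l j : nat)
    (r : cylinder_index n l j) (a b : 'I_n) (x : l.-tuple 'I_n) :
  cylinder R r (relabel (tperm a b) x) =
  cylinder R (r.1, config_relabel (tperm a b) r.2) x.
Proof.
rewrite /cylinder relabel_uniq; congr ((_ && _)%:R) => /=.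
have -> : restrict_balls (val r.1) (relabel (tperm a b) x) =
          map (tperm a b) (restrict_balls (val r.1) x).
  by rewrite /restrict_balls -map_comp; apply: eq_map => i; rewrite /= tnth_mktuple.
rewrite val_relabel -(inj_eq (inj_map (@perm_inj _ (tperm a b)))) -map_comp.
by rewrite (eq_map (tpermK a b)) map_id.
Qed.

Definition cylinder_mx (R : pzRingType) (n l j : nat) :
    'M[R]_(#|{: cylinder_index n l j}|, #|{: config n l}|) :=
  \matrix_(r, i) cylinder R (enum_val r) (val (enum_val i)).

Lemma row_cylinder_mx (R : pzRingType) (n l j : nat) r :
  row r (cylinder_mx R n l j) = (col_of_fun (cylinder R (enum_val r)))^T.
Proof. by apply/rowP => i; rewrite !mxE. Qed.

(** A transposition of vertices permutes the cylinders on the same balls. *)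
Lemma cylinder_mx_stable (R : realType) (n l j : nat) (alpha : R) :
  (cylinder_mx R n l j *m (- lep_generator n l alpha) <= cylinder_mx R n l j)%MS.
Proof.
apply/row_subP => r; set S := cylinder_mx R n l j.
pose r' a b := enum_rank ((enum_val r).1,
  config_relabel (tperm a b) (enum_val r).2 : config n j).
have -> : row r (S *m - lep_generator n l alpha) =
    (alpha / 2) *: ((n ^ 2)%:R *: row r S
                     - \sum_(a < n) \sum_(b < n) row (r' a b) S).
  rewrite row_mul row_cylinder_mx lep_mul_row; last exact: cylinder_supported.
  apply/rowP => i; rewrite !mxE; congr (_ * (_ - _)).
  rewrite summxE; apply: eq_bigr => a _; rewrite summxE; apply: eq_bigr => b _.
  by rewrite !mxE enum_rankK cylinder_relabel.
apply/scalemx_sub/addmx_sub; first by rewrite scalemx_sub // row_sub.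
rewrite -scaleN1r scalemx_sub // summx_sub // => a _.
by rewrite summx_sub // => b _; rewrite row_sub.
Qed.

(** The cylinder through [z] is a row of the matrix, up to the case where [z]
    repeats a vertex on [J] and the cylinder contains no configuration. *)
Lemma cylinder_mx_ker (R : pzRingType) (n l j : nat)
    (w : 'cV[R]_#|{: config n l}|) (J : {set 'I_l}) (z : l.-tuple 'I_n) :
  cylinder_mx R n l j *m w = 0 -> #|J| = j ->
  \sum_(x : l.-tuple 'I_n | [forall k in J, tnth x k == tnth z k])
     fun_of_col w x = 0.
Proof.
move=> Sw Jj; have sz : size (restrict_balls J z) == j.
  by rewrite size_map -cardE Jj.
have cylE x : [forall k in J, tnth x k == tnth z k] =
    (restrict_balls J x == restrict_balls J z).
  apply/forall_inP/eqP => [h|/eq_in_map h k kJ].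
    by apply/eq_in_map => k; rewrite mem_enum => /h/eqP.
  by apply/eqP/h; rewrite mem_enum.
rewrite (eq_bigl _ _ cylE).
have [uz|uz] := boolP (uniq (restrict_balls J z)); last first.
  rewrite big1 // => x /eqP xz; apply: fun_of_col_supported.
  apply: contraNN uz => /tuple_uniqP inj.
  by rewrite -xz map_inj_uniq ?enum_uniq.
pose r : cylinder_index n l j :=
  (exist _ J (introT eqP Jj), exist _ (Tuple sz) uz).
have := congr1 (fun A : 'M_(_, _) => row (enum_rank r) A) Sw.
rewrite row_mul row_cylinder_mx enum_rankK row0 => /matrixP/(_ 0 0).
rewrite mul_row_col_of_fun mxE => e; rewrite -[RHS]e big_mkcond.
apply: eq_bigr => x _; rewrite /cylinder /=.
have [_|/(fun_of_col_supported w)->] := boolP (uniq x); last by rewrite mulr0 if_same.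
by case: ifP => _; rewrite ?mul1r ?mul0r.
Qed.

(** The condition [j <= n - l] keeps every [k] with [j < k <= l] at most
    [n - j], so that [k * (n - k + 1)] is at least its value at [j + 1]. *)
Lemma multiplicity_window (R : realType) (n l j : nat) (alpha : R) :
  0 < alpha -> (1 <= l <= n)%N -> (1 <= j <= minn l (n - l))%N ->
  leq (\big[addn/0%N]_(lambda \in
         [set lambda : R |
           spectrum (- lep_generator n l alpha) lambda /\
           alpha * (j * (n - j + 1))%:R <= lambda
             < alpha * ((j + 1) * (n - j))%:R])
         multiplicity (- lep_generator n l alpha) lambda)
      (n ^_ j * 'C(l, j)).
Proof.
move=> a0 /andP[l1 ln]; rewrite leq_min => /andP[j1 /andP[jl jnl]].
rewrite -card_cylinder_index.
apply: leq_trans (rank_leq_row (cylinder_mx R n l j)).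
apply: sum_eigenvalues_le => [|lambda w [_ /andP[_ lam_lt]] wn0 Sw Qw].
  exact: cylinder_mx_stable.
have ef := lep_eigen_fun_of_col (lt0r_neq0 a0) Qw wn0.
have [|k [/andP[jk kl] kn ck]] := eigenfunction_level_bound _ ef
  (fun J z => cylinder_mx_ker z Sw).
  by rewrite jl ln.
(* The difference of the two sides is (k - j - 1) * (n - j - k). *)
have gap : ((j + 1) * (n - j) <= k * (n - k + 1))%N.
  have [d kE] : exists d, k = (j + 1 + d)%N by exists (k - (j + 1))%N; lia.
  have [e nE] : exists e, n = (k + j + e)%N by exists (n - (k + j))%N; lia.
  by rewrite nE kE; nia.
move: lam_lt; apply/negP; rewrite -leNgt.
have : alpha * ((j + 1) * (n - j))%:R <= alpha * (k * (n - k + 1))%:R.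
  by rewrite ler_pM2l // ler_nat.
move=> /le_trans; apply.
move: ck; rewrite !natrX !natrM natrD natrB ?(ltnW kn) // => ck.
have lE : lambda = alpha * (2 * lambda / alpha) / 2 by field; rewrite lt0r_neq0.
rewrite lE -mulrA ler_pM2l //; lra.
Qed.

(** * The multiplicity of alpha n *)

Lemma tperm_hit_count (R : pzRingType) (n : nat) (u v : 'I_n) :
  \sum_(a < n) \sum_(b < n) (tperm a b u == v)%:R =
  2 + (((n - 1) ^ 2)%:R - 1) * (u == v)%:R :> R.
Proof.
have [<-|uv] := eqVneq u v.
  rewrite mulr1 addrCA addrC -[2]/(1 + 1) addrK.
  have := relabel_tperm_fix_count R (x := [tuple u]) isT.
  rewrite natrD addrC => <-; apply: eq_bigr => a _; apply: eq_bigr => b _.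
  congr (nat_of_bool _)%:R; apply/eqP/eqP => [tu|/(congr1 (fun x => tnth x ord0))].
    by apply: eq_from_tnth => i; rewrite tnth_mktuple !(tnth_nth u) (ord1 i).
  by rewrite tnth_mktuple.
rewrite mulr0 addr0.
apply: (@sum_pair_indicator R n (fun a b => tperm a b u == v) u v uv).
- by rewrite tpermL.
- by rewrite tpermR.
by move=> a b /eqP tv; apply: tperm_moves tv _; rewrite eq_sym.
Qed.

(** Functions of the position of the single ball [r.1] with zero mean: vertex
    [ord0] serves as the reference for the [m] other vertices. *)
Definition ball_contrast (R : pzRingType) (m l : nat) (r : 'I_l * 'I_m)
    (x : l.-tuple 'I_m.+1) : R :=
  (uniq x)%:R * ((tnth x r.1 == lift ord0 r.2)%:R - (tnth x r.1 == ord0)%:R).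

Lemma ball_contrast_supported (R : pzRingType) (m l : nat) (r : 'I_l * 'I_m) :
  supported_on_configs (ball_contrast R r).
Proof. by move=> x /negPf ux; rewrite /ball_contrast ux mul0r. Qed.

Lemma ball_contrast_eigen (R : comNzRingType) (m l : nat) (r : 'I_l * 'I_m)
    (x : l.-tuple 'I_m.+1) :
  transposition_sum (ball_contrast R r) x =
  ((m ^ 2)%:R - 1) * ball_contrast R r x.
Proof.
rewrite /transposition_sum /ball_contrast.
under eq_bigr do under eq_bigr do rewrite relabel_uniq tnth_mktuple.
under eq_bigr do rewrite -mulr_sumr sumrB.
rewrite -mulr_sumr sumrB !tperm_hit_count subSS subn0; ring.
Qed.

Definition contrast_mx (R : pzRingType) (m l : nat) :
    'M[R]_(#|{: 'I_l * 'I_m}|, #|{: config m.+1 l}|) :=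
  \matrix_(r, i) ball_contrast R (enum_val r) (val (enum_val i)).

Lemma row_contrast_mx (R : pzRingType) (m l : nat) r :
  row r (contrast_mx R m l) = (col_of_fun (ball_contrast R (enum_val r)))^T.
Proof. by apply/rowP => i; rewrite !mxE. Qed.

Lemma contrast_mx_eigen (R : realType) (m l : nat) (alpha : R) :
  contrast_mx R m l *m (- lep_generator m.+1 l alpha) =
  (alpha * m.+1%:R) *: contrast_mx R m l.
Proof.
apply/row_matrixP => r; rewrite row_mul row_contrast_mx lep_mul_row; last first.
  exact: ball_contrast_supported.
apply/rowP => i; rewrite !mxE ball_contrast_eigen !natrX mulrSr.
by move: (ball_contrast _ _ _) => g; field.
Qed.

(** The action on vertices is doubly transitive, and one vertex is vacant. *)
Lemma two_transitive_config (m l : nat) (i : 'I_l) (u u' : 'I_m.+1) :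
  (l < m.+1)%N -> u != u' ->
  exists x : l.-tuple 'I_m.+1, [/\ uniq x, tnth x i = u & u' \notin x].
Proof.
move=> lm uu'; pose x0 : l.-tuple 'I_m.+1 := [tuple widen_ord (ltnW lm) k | k < l].
have ux0 : uniq x0.
  by apply/tuple_uniqP => a b; rewrite !tnth_mktuple => /(congr1 val) /= /val_inj.
have [v vx0] := fresh_vertex ux0 lm.
pose t := tperm (tnth x0 i) u; pose s := (t * tperm (t v) u')%g.
have vi : v != tnth x0 i by apply: contraNneq vx0 => ->; rewrite mem_tnth.
have su : s (tnth x0 i) = u.
  rewrite permM /t tpermL tpermD // 1?eq_sym //.
  apply: contra_neq vi => /(congr1 (tperm (tnth x0 i) u)).
  by rewrite tpermK tpermR.
exists (relabel s x0); split; [by rewrite relabel_uniq | by rewrite tnth_mktuple |].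
have <- : s v = u' by rewrite permM tpermL.
apply/tnthP => -[k]; rewrite tnth_mktuple => /perm_inj vk.
by rewrite vk mem_tnth in vx0.
Qed.

(** A linear relation between contrasts says that a sum of functions [C i] of the
    positions vanishes on all configurations.  Moving ball [i] alone shows that
    [C i] is constant, and it has zero sum by construction, so it is 0. *)
Lemma contrast_mx_free (R : realType) (m l : nat) :
  (l < m.+1)%N -> row_free (contrast_mx R m l).
Proof.
move=> lm; rewrite -kermx_eq0; apply/rowV0P => c /sub_kermxP cS.
pose C (i : 'I_l) (u : 'I_m.+1) : R :=
  if unlift ord0 u is Some v then c 0 (enum_rank (i, v))
  else - \sum_(v < m) c 0 (enum_rank (i, v)).
have CE i u : \sum_(v < m) c 0 (enum_rank (i, v)) *
    ((u == lift ord0 v)%:R - (u == ord0)%:R) = C i u.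
  rewrite /C; case: unliftP => [v ->|->].
    rewrite (bigD1 v) // eqxx [_ == ord0]eq_sym (negPf (neq_lift _ _)) subr0 mulr1.
    rewrite big1 /= ?addr0 // => v' v'v.
    by rewrite (inj_eq lift_inj) [v == _]eq_sym (negPf v'v) subr0 mulr0.
  rewrite -sumrN; apply: eq_bigr => v _.
  by rewrite eqxx (negPf (neq_lift _ _)) sub0r mulrN1.
have sumC (x : l.-tuple 'I_m.+1) : uniq x -> \sum_(i < l) C i (tnth x i) = 0.
  move=> ux.
  have := congr1 (fun A : 'rV_ _ => A 0 (enum_rank (exist _ x ux : config _ _))) cS.
  rewrite !mxE => e; rewrite -[RHS]e.
  rewrite (reindex_onto enum_rank enum_val) /= => [|r _]; last exact: enum_valK.
  under [RHS]eq_bigl do rewrite enum_rankK eqxx.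
  under eq_bigr do rewrite -CE.
  rewrite pair_big /=; apply: eq_bigr => -[i v] _.
  by rewrite mxE !enum_rankK /ball_contrast /= ux mul1r.
have Cconst i u u' : C i u = C i u'.
  have [->//|uu'] := eqVneq u u'.
  have [x [ux xi u'x]] := two_transitive_config i lm uu'.
  pose x' := relabel (tperm u u') x.
  have := etrans (sumC x' (etrans (relabel_uniq _ _) ux)) (esym (sumC x ux)).
  rewrite (bigD1 i) //= [in RHS](bigD1 i) //= tnth_mktuple xi tpermL.
  rewrite (eq_bigr (fun k => C k (tnth x k))) => [/addIr/esym //|k ki].
  rewrite tnth_mktuple tpermD // -?xi.
    by have /tuple_uniqP inj := ux; rewrite (inj_eq inj) eq_sym.
  by apply: contraNneq u'x => ->; rewrite mem_tnth.
apply/rowP => r; rewrite mxE -(enum_valK r); case: (enum_val r) => i v.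
have Cv w : c 0 (enum_rank (i, w)) = C i (lift ord0 w) by rewrite /C liftK.
have C0 : C i ord0 = - (C i ord0 *+ m).
  rewrite {1}/C unlift_none (eq_bigr (fun=> C i ord0)) => [|w _].
    by rewrite sumr_const card_ord.
  by rewrite Cv; exact: Cconst.
rewrite Cv (Cconst i _ ord0); apply/eqP.
have : C i ord0 *+ m.+1 == 0 by rewrite mulrS {1}C0 addNr.
by rewrite mulrn_eq0.
Qed.

(** Orthogonality to the contrasts makes the marginal on each ball constant.  The
    total of [w] vanishes because constants are eigenfunctions for another
    eigenvalue, so this constant is 0. *)
Lemma contrast_mx_cylinder (R : realType) (m l : nat) (c : R)
    (w : 'cV[R]_#|{: config m.+1 l}|) :
  contrast_mx R m l *m w = 0 -> eigenfunction c (fun_of_col w) ->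
  c != (m.+1 ^ 2)%:R ->
  forall (J : {set 'I_l}) (z : l.-tuple 'I_m.+1), #|J| = 1%N ->
  \sum_(x : l.-tuple 'I_m.+1 | [forall k in J, tnth x k == tnth z k])
     fun_of_col w x = 0.
Proof.
move=> Sw [sf _ Tf] cn J z /eqP/cards1P[i ->{J}].
have total : \sum_x fun_of_col w x = 0.
  have : \sum_x transposition_sum (fun_of_col w) x = c * \sum_x fun_of_col w x.
    by rewrite mulr_sumr; apply: eq_bigr => x _.
  rewrite /transposition_sum exchange_big /=.
  rewrite (eq_bigr (fun=> m.+1%:R * \sum_x fun_of_col w x)) => [|a _]; last first.
    rewrite exchange_big /= (eq_bigr (fun=> \sum_x fun_of_col w x)) => [|b _].
      by rewrite sumr_const card_ord mulr_natl.
    by rewrite [RHS](reindex_inj (inv_inj (relabel_tpermK a b))).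
  rewrite sumr_const card_ord -mulrnAl -mulrnA mulnn => /eqP.
  rewrite -subr_eq0 -mulrBl mulf_eq0 subr_eq0 eq_sym (negPf cn) /=.
  by move/eqP.
pose M v := \sum_(x : l.-tuple 'I_m.+1 | tnth x i == v) fun_of_col w x.
have ME v : M v = \sum_x (tnth x i == v)%:R * fun_of_col w x.
  rewrite /M big_mkcond; apply: eq_bigr => x _.
  by case: ifP => _; rewrite ?mul1r ?mul0r.
have M0 v : M v = M ord0.
  have [v' ->|-> //] := unliftP ord0 v.
  have := congr1 (fun A : 'M_(_, _) => row (enum_rank (i, v')) A) Sw.
  rewrite row_mul row_contrast_mx enum_rankK row0 => /matrixP/(_ 0 0).
  rewrite mul_row_col_of_fun mxE => e; apply/eqP; rewrite -subr_eq0 -[X in _ == X]e.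
  apply/eqP; rewrite !ME -sumrB; apply: eq_bigr => x _.
  rewrite /ball_contrast /= -mulrBl.
  have [_|/(fun_of_col_supported w)->] := boolP (uniq x); last by rewrite !mulr0.
  by rewrite mul1r.
have sumM : \sum_v M v = 0.
  by rewrite -[RHS]total (partition_big (fun x : l.-tuple 'I_m.+1 => tnth x i) predT).
move: sumM; rewrite (eq_bigr _ (fun v _ => M0 v)) sumr_const card_ord => /eqP.
rewrite mulrn_eq0 /= -(M0 (tnth z i)) => /eqP e; rewrite -[RHS]e.
apply: eq_bigl => x; apply/forall_inP/idP => [/(_ i)|xi k].
  by apply; rewrite inE.
by rewrite inE => /eqP->.
Qed.

(** The contrasts span a subspace of the eigenspace, so they contribute exactly
    their number; an eigenvector orthogonal to them would have an eigenvalue at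
    least [alpha * k * (n - k + 1)] with [2 <= k < n]. *)
Lemma multiplicity_gap (R : realType) (n l : nat) (alpha : R) :
  0 < alpha -> (1 <= l <= n)%N -> (l < n)%N || (n == 1%N) ->
  multiplicity (- lep_generator n l alpha) (alpha * n%:R) = (l * (n - 1))%N.
Proof.
move=> a0 /andP[l1 ln]; have an0 := lt0r_neq0 a0.
have [n1 _|n1] := eqVneq n 1%N.
  have l_eq : l = 1%N by apply/eqP; rewrite eqn_leq l1 -n1 ln.
  rewrite n1 l_eq subnn muln0; apply: mupNroot; rewrite -eigenvalue_root_char.
  apply/negP => /(spectrum_lep_Eset an0 (leqnn 1)) /eqP.
  by rewrite mulr1 (negPf an0).
case: n ln n1 => [|m] ln n1; first by rewrite leqn0 in ln; rewrite (eqP ln) in l1.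
rewrite orbF => lm.
have SM := contrast_mx_eigen m l alpha.
have [|p [q [Mpq sp pE qw]]] := @char_poly_stablemx _ _ _ (contrast_mx R m l)
  (- lep_generator m.+1 l alpha); first by rewrite SM scalemx_sub.
have qroot : ~~ root q (alpha * m.+1%:R).
  apply/negP => /qw[w [wn0 Sw Mw]].
  have ef := lep_eigen_fun_of_col an0 Mw wn0.
  have cE : (m.+1 ^ 2)%:R - 2 * (alpha * m.+1%:R) / alpha =
            (m.+1 ^ 2)%:R - (2 * m.+1)%:R :> R by rewrite natrM; field.
  rewrite cE in ef.
  have cn : (m.+1 ^ 2)%:R - (2 * m.+1)%:R != (m.+1 ^ 2)%:R :> R.
    by rewrite -subr_eq0 addrAC addrN sub0r oppr_eq0 pnatr_eq0.
  have [|k [/andP[k1 kl] km ck]] := eigenfunction_level_bound _ ef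
    (contrast_mx_cylinder Sw ef cn); first by rewrite l1 ltnW.
  (* k (n - k + 1) - n = (k - 1) (n - k) is positive. *)
  have : (m.+1 < k * (m.+1 - k + 1))%N by nia.
  rewrite -(ltr_nat R); move: ck.
  by rewrite !natrX !natrM natrD natrB ?(ltnW km) //; nra.
rewrite /multiplicity Mpq mupMl // (pE _ SM) mup_XsubCX eqxx.
have := contrast_mx_free R lm; rewrite /row_free => /eqP->.
by rewrite card_prod !card_ord subSS subn0.
Qed.

Theorem theorem1p2 (R : realType) (n : nat) (alpha : R)
    (hn : (0 < n)%N) (halpha : 0 < alpha) :
  [/\ (forall l l' : nat, (1 <= l)%N -> (l <= l')%N -> (l' <= n)%N ->
         spectrum (- lep_generator n l alpha)
           `<=` spectrum (- lep_generator n l' alpha))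
      /\ (forall l : nat, (1 <= l <= n)%N ->
         spectrum (- lep_generator n l alpha) `<=` Eset alpha n l),
      [/\ spectrum (- lep_generator n n alpha)
            `<=` largest_symmetric_subset (alpha * 'C(n, 2)%:R)
                   (Eset alpha n n),
          symmetric_around 0 (spectrum (cayley_adj R n)) &
          spectrum (cayley_adj R n)
            `<=` largest_symmetric_subset 0
                   [set 'C(n, 2)%:R - alpha^-1 * e | e in Eset alpha n n]],
      (forall l j : nat, (1 <= l <= n)%N -> (1 <= j <= minn l (n - l))%N ->
         leq (\big[addn/0%N]_(lambda \in
                [set lambda : R |
                  spectrum (- lep_generator n l alpha) lambda /\
                  alpha * (j * (n - j + 1))%:R <= lambda
                    < alpha * ((j + 1) * (n - j))%:R])
                multiplicity (- lep_generator n l alpha) lambda)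
             (n ^_ j * 'C(l, j))) &
      (forall l : nat, (1 <= l <= n)%N -> (l < n)%N || (n == 1%N) ->
         multiplicity (- lep_generator n l alpha) (alpha * n%:R)
           = (l * (n - 1))%N)].
Proof.
have an0 := lt0r_neq0 halpha; split.
- split=> [l l' _ ll' l'n|l /andP[_ ln]]; first exact: spectrum_lep_mono.
  exact: spectrum_lep_Eset.
- split; last 1 first.
  + apply: largest_symmetric_subset_sup; first exact: spectrum_cayley_sym.
    exact: spectrum_cayley_Eset.
  + apply: largest_symmetric_subset_sup; first exact: spectrum_lep_full_sym.
    exact: spectrum_lep_Eset.
  + exact: spectrum_cayley_sym.
- by move=> l j; exact: multiplicity_window.
- by move=> l; exact: multiplicity_gap.
Qed.
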